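(* Consider the i.i.d. contextual bandit problem and run the algorithm ILOVETOCONBANDITS (defined in the context) with failure probability $\delta\in(0,1)$ and an epoch schedule $0=\tau_0<\tau_1<\tau_2<\cdots$ satisfying $\tau_{m+1}\le 2\tau_m$ for all $m\ge 1$ and $\tau_1=O(1)$. Assume the optimization problem (OP) can be solved whenever the algorithm requires it. Then for every $T\ge 1$, with probability at least $1-\delta$, the regret of the algorithm after $T$ rounds is $$O\left(\sqrt{KT\ln(T|\Pi|/\delta)}+K\ln(T|\Pi|/\delta)\right),$$ where the hidden constant depends only on the constant bounding $\tau_1$.
   Context: Setting. $A$ is a finite set of $K$ actions, $X$ a space of contexts, $\Pi\subseteq A^X$ a finite nonempty set of policies, $\mathcal D$ a probability distribution over $X\times[0,1]^A$. Pairs $(x_t,r_t)$ are i.i.d. from $\mathcal D$; in round $t$ the agent observes $x_t$, randomly chooses $a_t$ (with probability $p_t(a_t)$), and receives $r_t(a_t)$. $H_t$ is the history of records $(x_i,a_i,r_i(a_i),p_i(a_i))$, $i\le t$. $\mathcal R(\pi)=\mathbb E_{(x,r)\sim\mathcal D}[r(\pi(x))]$, $\pi_\star\in\arg\max_{\pi\in\Pi}\mathcal R(\pi)$. The regret after $T$ rounds is $\sum_{t=1}^T(r_t(\pi_\star(x_t))-r_t(a_t))$. Estimates. $\widehat{\mathcal R}_t(\pi)=\frac1t\sum_{i=1}^t\frac{r_i(a_i)\mathbf 1\{\pi(x_i)=a_i\}}{p_i(a_i)}$; $\pi_t\in\arg\max_{\pi\in\Pi}\widehat{\mathcal R}_t(\pi)$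 ($\pi_0$ arbitrary); $\widehat{\mathrm{Reg}}_t(\pi)=\widehat{\mathcal R}_t(\pi_t)-\widehat{\mathcal R}_t(\pi)$. $\widehat{\mathbb E}_{x\sim H_t}$ is expectation over $x$ uniform among the $t$ contexts of $H_t$. Weights. $\Delta^\Pi=\{Q\in\mathbb R^\Pi: Q(\pi)\ge 0\ \forall\pi,\ \sum_\pi Q(\pi)\le 1\}$. $Q(a|x)=\sum_{\pi:\pi(x)=a}Q(\pi)$ and $Q^\mu(a|x)=(1-K\mu)Q(a|x)+\mu$ for $\mu\in[0,1/K]$. (OP). Given $H_t$ and $\mu_m$, let $b_\pi=\widehat{\mathrm{Reg}}_t(\pi)/(\psi\mu_m)$ with $\psi=100$. Find $Q\in\Delta^\Pi$ with $\sum_\pi Q(\pi)b_\pi\le 2K$ and, for all $\pi\in\Pi$, $\widehat{\mathbb E}_{x\sim H_t}[1/Q^{\mu_m}(\pi(x)|x)]\le 2K+b_\pi$. Algorithm ILOVETOCONBANDITS. Set $\mu_0=1/(2K)$ and $\mu_m=\min\{\frac1{2K},\sqrt{\ln(16\tau_m^2|\Pi|/\delta)/(K\tau_m)}\}$ for $m\ge 1$; $Q_0=\mathbf 0$, $m=1$. In each round $t=1,2,\dots$: observe $x_t$; let $\tilde Q_{m-1}=Q_{m-1}+(1-\sum_\pi Q_{m-1}(\pi))\mathbf 1_{\pi_{\tau_{m-1}}}$; draw $a_t$ from $\tilde Q_{m-1}^{\mu_{m-1}}(\cdot|x_t)$ and set $p_t(a_t)=\tilde Q_{m-1}^{\mu_{m-1}}(a_t|x_t)$;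 observe $r_t(a_t)$; if $t=\tau_m$, let $Q_m$ be a solution of (OP) with history $H_t$ and minimum probability $\mu_m$, and set $m:=m+1$. *)

(* Defs.v *)
From HB Require Import structures.
From mathcomp Require Import all_boot all_order all_algebra.
From mathcomp Require Import finmap.
From mathcomp Require Import all_classical all_reals all_analysis.

Set Implicit Arguments.
Unset Strict Implicit.
Unset Printing Implicit Defensive.

Import Order.TTheory GRing.Theory Num.Theory.
Import numFieldNormedType.Exports.

Local Open Scope classical_set_scope.
Local Open Scope ring_scope.

(* A reward vector in R^A is a tuple indexed by [enum_rank] (tuples carry the
   product sigma-algebra). *)
Notation rewards R A := (#|A|.-tuple (measurableTypeR R)).

Definition reward {R : realType} {A : finType} (r : rewards R A) (a : A) : R :=
  tnth r (enum_rank a).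

Section Estimates.
Context {R : realType} {X : Type} {A : finType} {Pi : {fset (X -> A)}}.

Record entry := Entry {
  e_ctx : X ; e_act : A ; e_rew : R ; e_prb : R }.

Definition history := seq entry.

Implicit Types (H : history) (p q : Pi) (Q : Pi -> R).

Definition ips_reward H p : R :=
  (size H)%:R^-1 *
  \sum_(h <- H) (e_rew h * (val p (e_ctx h) == e_act h)%:R / e_prb h).

Definition emp_leader H p : Prop := forall q, ips_reward H q <= ips_reward H p.

(* [l] is the chosen empirical leader. *)
Definition emp_regret H (l p : Pi) : R := ips_reward H l - ips_reward H p.

Definition emp_expectation H (f : X -> R) : R :=
  (size H)%:R^-1 * \sum_(h <- H) f (e_ctx h).

Definition subdistribution Q : Prop :=
  (forall p, 0 <= Q p) /\ \sum_(p : Pi) Q p <= 1.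

Definition action_weight Q (a : A) (x : X) : R :=
  \sum_(p : Pi | val p x == a) Q p.

Definition smoothed Q (mu : R) (a : A) (x : X) : R :=
  (1 - #|A|%:R * mu) * action_weight Q a x + mu.

Definition completed Q (l : Pi) : Pi -> R :=
  fun p => Q p + (1 - \sum_(q : Pi) Q q) * (p == l)%:R.

Definition psi : R := 100.

Definition op_slack H (l : Pi) (mu : R) (p : Pi) : R :=
  emp_regret H l p / (psi * mu).

Definition solves_OP H (l : Pi) (mu : R) Q : Prop :=
  [/\ subdistribution Q,
      \sum_(p : Pi) Q p * op_slack H l mu p <= 2 * #|A|%:R
    & forall p, emp_expectation H (fun x => 1 / smoothed Q mu (val p x) x)
                <= 2 * #|A|%:R + op_slack H l mu p].

End Estimates.
Arguments entry : clear implicits.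
Arguments history : clear implicits.

Definition epoch_schedule (tau : nat -> nat) : Prop :=
  [/\ tau 0%N = 0%N,
      forall m, (tau m < tau m.+1)%N
    & forall m, (1 <= m)%N -> (tau m.+1 <= 2 * tau m)%N].

(* The epoch counter m starts at 1 and is incremented at the end of round
   tau m; [epochs_done tau t] is the value of m - 1 after round t. *)
Fixpoint epochs_done (tau : nat -> nat) (t : nat) : nat :=
  if t is s.+1 then
    let k := epochs_done tau s in if s.+1 == tau k.+1 then k.+1 else k
  else 0.

(* [K] is the number of actions, [N] the number of policies. *)
Definition min_prob {R : realType} (K N : nat) (delta : R) (tau : nat -> nat)
    (m : nat) : R :=
  if m is 0 then 1 / (2 * K%:R)
  else Num.min (1 / (2 * K%:R))
         (Num.sqrt (ln (16 * (tau m)%:R ^+ 2 * N%:R / delta)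
                    / (K%:R * (tau m)%:R))).

Section Algorithm.
Context {R : realType} {X : Type} {A : finType} {Pi : {fset (X -> A)}}.
Variables (delta : R) (tau : nat -> nat).

(* One realization of a run. Rounds are numbered from 1 (index 0 of [ctx],
   [rwd] and [act] is unused); [wgt m] is Q_m and [ldr t] is pi_t. *)
Record trajectory := Trajectory {
  ctx : nat -> X ;
  rwd : nat -> rewards R A ;
  act : nat -> A ;
  wgt : nat -> Pi -> R ;
  ldr : nat -> Pi }.

Implicit Type z : trajectory.

Definition mu_ (m : nat) : R := min_prob #|A| #|` Pi| delta tau m.

Definition act_prob z (t : nat) (a : A) : R :=
  let k := epochs_done tau t.-1 in
  smoothed (completed (wgt z k) (ldr z (tau k))) (mu_ k) a (ctx z t).

Definition hist z (t : nat) : history R X A :=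
  [seq Entry (ctx z i) (act z i) (reward (rwd z i) (act z i))
             (act_prob z i (act z i)) | i <- iota 1 t].

Definition regret z (pistar : Pi) (T : nat) : R :=
  \sum_(1 <= t < T.+1)
    (reward (rwd z t) (val pistar (ctx z t)) - reward (rwd z t) (act z t)).

Definition follows_updates z : Prop :=
  [/\ forall t, emp_leader (hist z t) (ldr z t),
      forall p, wgt z 0%N p = 0
    & forall m, (1 <= m)%N ->
        solves_OP (hist z (tau m)) (ldr z (tau m)) (mu_ m) (wgt z m)].

End Algorithm.
Arguments trajectory R {X A} Pi.

Section Probability.
Context {R : realType}.

Definition filtration d (T : measurableType d) (F : nat -> set (set T)) : Prop :=
  [/\ forall t, sigma_algebra setT (F t),
      forall t, F t `<=` measurable
    & forall t, F t `<=` F t.+1].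

Definition measurable_wrt (T : Type) d (U : measurableType d)
    (G : set (set T)) (f : T -> U) : Prop :=
  forall B, measurable B -> G (f @^-1` B).

Context d (X : measurableType d) (A : finType).

Definition reward_distribution
    (D : probability (X * rewards R A)%type R) : Prop :=
  D [set xr | forall a, 0 <= reward xr.2 a <= 1] = 1%E.

Definition measurable_policies (Pi : {fset (X -> A)}) : Prop :=
  forall (p : Pi) (a : A), measurable (val p @^-1` [set a]).

Definition policy_reward (Pi : {fset (X -> A)})
    (D : probability (X * rewards R A)%type R) (p : Pi) : \bar R :=
  ('E_D[fun xr => reward xr.2 (val p xr.1)])%E.

Definition optimal_policy (Pi : {fset (X -> A)})
    (D : probability (X * rewards R A)%type R) (p : Pi) : Prop :=
  forall q : Pi, (policy_reward D q <= policy_reward D p)%E.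

(* [F t] is the information available after round t. It may be larger than the
   sigma-algebra generated by the first t rounds, so that the choice of pi_t
   and Q_m among the admissible ones may be randomized. The
   pair drawn in round t.+1 has law [D] and is independent of [F t]; given
   [F t] and that pair, a_(t.+1) is drawn from [act_prob]. *)
Record ilovetoconbandits_run (Pi : {fset (X -> A)})
    (D : probability (X * rewards R A)%type R) (delta : R) (tau : nat -> nat)
    d' (Omega : measurableType d') (P : probability Omega R)
    (F : nat -> set (set Omega)) (Z : Omega -> trajectory R Pi) : Prop := {
  run_filtration : filtration F ;
  run_adapted_data : forall t,
    measurable_wrt (F t.+1) (fun w => (ctx (Z w) t.+1, rwd (Z w) t.+1)) ;
  run_adapted_act : forall t a, F t.+1 [set w | act (Z w) t.+1 = a] ;
  run_adapted_ldr : forall t p, F t [set w | ldr (Z w) t = p] ;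
  run_adapted_wgt : forall m p,
    measurable_wrt (F (tau m)) (fun w => wgt (Z w) m p : measurableTypeR R) ;
  run_iid : forall t E B, F t E -> measurable B ->
    P (E `&` [set w | B (ctx (Z w) t.+1, rwd (Z w) t.+1)]) = (P E * D B)%E ;
  run_draw : forall t E B a, F t E -> measurable B ->
    let G := E `&` [set w | B (ctx (Z w) t.+1, rwd (Z w) t.+1)] in
    P (G `&` [set w | act (Z w) t.+1 = a]) =
    (\int[P]_(w in G) (act_prob delta tau (Z w) t.+1 a)%:E)%E ;
  run_updates : forall w, follows_updates delta tau (Z w) }.

End Probability.

(* Main.v *)
(** The randomness enters through a single device: a sum of increments whose
    conditional exponential moment given the past is at most 1 exceeds ln (1/e)
    with probability at most e.  It is applied, with a union bound, to
    (1) the importance-weighted reward estimates at the end of each epoch,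
    (2) the empirical versus the true expectation of 1/Q^mu, and
    (3) the regret itself.
    In (2) the weights Q_m depend on the sample, so the bound has to hold
    uniformly over the simplex: Q is replaced by n ~ 1/mu policies drawn
    i.i.d. from Q (Maurey), which costs only n ln |Pi| in the union bound.
    Outside the exceptional event, induction over the epochs shows that the
    empirical and the true regret of every policy agree up to a factor 2 and
    an additive O(K mu_m).  The first constraint of (OP) then makes the
    expected regret of a round of epoch m O(K mu_m), and
    mu_m = O(sqrt (ln / (K t))) in that epoch since tau_(m+1) <= 2 tau_m. *)

Require Import Defs.
From HB Require Import structures.
From mathcomp Require Import all_boot all_order all_algebra.
From mathcomp Require Import finmap.
From mathcomp Require Import all_classical all_reals all_analysis.
From mathcomp Require Import measurable_realfun ring lra.

Set Implicit Arguments.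
Unset Strict Implicit.
Unset Printing Implicit Defensive.

Import Order.TTheory GRing.Theory Num.Theory.
Import numFieldNormedType.Exports.

Local Open Scope classical_set_scope.
Local Open Scope ring_scope.

(** * Integrals against conditional laws *)

(** A run is constrained only through the measure of rectangles: an event of [F t], a set of fresh
    pairs, a drawn action. Conditional expectations are therefore avoided: [F t] is made into a
    measurable type, the rectangle identities are extended to functions on its product with the
    space of pairs, and conditioning on the past becomes integrating over the pair and the action
    with the outcome held fixed. The cap [1 / (2K)] splits the argument. Below it,
    [ln (16 tau^2 |Pi| / delta)] equals [K tau mu^2], so each tail bound turns into a multiple of
    [K mu]. At the cap nothing is claimed about the estimates, since [1 / mu = 2K] and a regret of 1
    is [2 K mu]. The last obstacle is that the logarithm [L] of the theorem can be close to 0, so it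
    cannot always pay for the constants of the union bound. It is at least [ln 2] unless
    [T = |Pi| = 1] and [delta > 1/2], and that case is settled by computing the probability of the
    first action. *)

Section Density.
Local Open Scope ereal_scope.
Context d (T : measurableType d) (R : realType).
Context (m : {measure set T -> \bar R}) (h : T -> R).
Context (h0 : forall x, (0 <= h x)%R).
Context (mh : measurable_fun setT h).
Let mh' : measurable_fun setT (fun x => (h x)%:E).
Proof. exact/measurable_EFinP. Qed.

(** The two proofs are arguments so that the measure structure can be inferred from the term
    [density h0 mh]. *)
Definition density of (forall x, (0 <= h x)%R) & measurable_fun setT h :=
  fun S : set T => \int[m]_(x in S) (h x)%:E.

Local Notation nu := (density h0 mh).

Let density0 : nu set0 = 0.
Proof. by rewrite /density integral_set0. Qed.

Let density_ge0 S : 0 <= nu S.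
Proof. by apply: integral_ge0 => x _; rewrite lee_fin. Qed.

Let density_sigma_additive : semi_sigma_additive nu.
Proof.
move=> F mF tF mUF; rewrite /density; apply: cvg_toP.
  apply: ereal_nondecreasing_is_cvgn => i j ij.
  apply: lee_sum_nneg_natr => // k _ _.
  by apply: integral_ge0 => x _; rewrite lee_fin.
rewrite ge0_integral_bigcup//.
- exact: measurable_funTS.
- by move=> x _; rewrite lee_fin.
Qed.

HB.instance Definition _ := isMeasure.Build _ _ _ nu
  density0 density_ge0 density_sigma_additive.

Import HBNNSimple.

Let integral_density_nnsfun (f : {nnsfun T >-> R}) :
  \int[nu]_x (f x)%:E = \int[m]_x ((h x)%:E * (f x)%:E).
Proof.
under [LHS]eq_integral do rewrite fimfunE -fsumEFin//.
rewrite [LHS]ge0_integral_fsum//; last 2 first.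
  - by move=> r; exact/measurable_EFinP/measurableT_comp.
  - by move=> n x _; rewrite EFinM nnfun_muleindic_ge0.
under [RHS]eq_integral.
  move=> x xD; rewrite fimfunE -fsumEFin// ge0_mule_fsumr; last first.
    by move=> r; rewrite EFinM nnfun_muleindic_ge0.
  over.
rewrite [RHS]ge0_integral_fsum//; last 2 first.
  - move=> r; apply: emeasurable_funM => //; apply/measurable_EFinP.
    by apply: measurableT_comp.
  - by move=> n x _; rewrite EFinM mule_ge0 ?nnfun_muleindic_ge0 ?lee_fin.
apply: eq_fsbigr => r _.
rewrite integralZl_indic_nnsfun//= integral_indic// setIT.
rewrite -[X in r%:E * X]/(\int[m]_(x in f @^-1` [set r]) (h x)%:E).
have [r0|r0] := ltP r 0%R.
  rewrite preimage_nnfun0// integral_set0 mule0.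
  by rewrite integral0_eq// => x _; rewrite indic0 mulr0 mule0.
rewrite -ge0_integralZl//; last 2 first.
  - exact: measurable_funTS.
  - by move=> x _; rewrite lee_fin.
rewrite [LHS]integral_mkcond; apply: eq_integral => x _.
rewrite patchE indicE; case: ifPn => _; rewrite ?mulr1 ?mulr0 ?mule0//=.
by rewrite muleC.
Qed.

Lemma ge0_integral_density (f : T -> \bar R) :
  measurable_fun setT f -> (forall x, 0 <= f x) ->
  \int[nu]_x f x = \int[m]_x ((h x)%:E * f x).
Proof.
move=> mf f0; pose f_ := nnsfun_approx measurableT mf.
have cvgf x : (f_ n x)%:E @[n --> \oo] --> f x.
  by apply: cvg_nnsfun_approx.
transitivity (lim (\int[nu]_x (f_ n x)%:E @[n --> \oo])).
  rewrite -monotone_convergence//=.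
  - by apply: eq_integral => x _; apply/esym/cvg_lim.
  - by move=> n; exact/measurable_EFinP/measurable_funTS.
  - by move=> n ? _; rewrite lee_fin.
  - by move=> ? _ ? ? mn; rewrite lee_fin; exact/lefP/nd_nnsfun_approx.
transitivity (lim (\int[m]_x ((h x)%:E * (f_ n x)%:E) @[n --> \oo])).
  by apply: congr_lim; apply/funext => n /=; exact: integral_density_nnsfun.
rewrite -monotone_convergence//=.
- apply: eq_integral => x _; rewrite limeMl//.
    by rewrite (cvg_lim _ (cvgf x)).
  by apply/cvg_ex; exists (f x); exact: cvgf.
- move=> n; apply: emeasurable_funM => //.
  exact/measurable_EFinP/measurable_funTS.
- by move=> n x _; rewrite mule_ge0 ?lee_fin//.
- move=> x _ n k nk; rewrite lee_wpmul2l ?lee_fin//.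
  exact/lefP/nd_nnsfun_approx.
Qed.

End Density.

Section OneRound.
Local Open Scope ereal_scope.
Context d (W : measurableType d) d' (V : measurableType d') (A : finType).
Context (R : realType) (P : probability W R) (D : probability V R).
Context (G : set (set W)) (y : W -> V) (act : W -> A) (q : W -> V -> A -> R).
Context (GS : sigma_algebra setT G) (GM : G `<=` measurable).
Context (my : measurable_fun setT y).
Context (mact : forall a, measurable [set w | act w = a]).
Context (indep : forall E B, G E -> measurable B ->
  P (E `&` y @^-1` B) = P E * D B).
Local Notation WG := (g_sigma_algebraType G).
Context (q0 : forall w v a, (0 <= q w v a)%R).
Context (mq : forall a, measurable_fun setT (fun z : WG * V => q z.1 z.2 a)).
Context (draw : forall E B a, G E -> measurable B ->
  P (E `&` y @^-1` B `&` [set w | act w = a]) =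
  \int[P]_(w in E `&` y @^-1` B) (q w (y w) a)%:E).

Lemma measurable_gen (E : set WG) : measurable E = G E.
Proof. by rewrite measurable_g_measurableTypeE. Qed.

(** The identity from the full sigma-algebra to the coarser [G]; its law is [P] restricted to
    [G]. *)
Let idG (w : W) : WG := w.

Let midG : measurable_fun setT idG.
Proof. by move=> _ E; rewrite measurable_gen setTI => /GM. Qed.

HB.instance Definition _ := isMeasurableFun.Build _ _ _ _ idG midG.

Let Phi (w : W) : WG * V := (w, y w).

Let mPhi : measurable_fun setT Phi.
Proof. exact: (measurable_fun_pair midG my). Qed.

HB.instance Definition _ := isMeasurableFun.Build _ _ _ _ Phi mPhi.

(** Independence gives the law of [(w, y w)] on rectangles, uniqueness of product measures
    identifies it with the product of [P] on [G] and [D], and Tonelli separates the integrals. *)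
Lemma joint_law (f : WG * V -> \bar R) :
  measurable_fun setT f -> (forall z, 0 <= f z) ->
  \int[P]_w f (w, y w) = \int[P]_w \int[D]_v f (w, v).
Proof.
move=> mf f0.
transitivity (\int[distribution P Phi]_z f z).
  by rewrite ge0_integral_pushforward.
transitivity (\int[distribution P idG \x D]_z f z).
  apply/esym/eq_measure_integral => S mS _.
  apply: product_measure_unique => // E B; rewrite measurable_gen => GE mB.
  by rewrite /distribution /pushforward/= -indep.
rewrite fubini_tonelli1// ge0_integral_pushforward//.
- exact: measurable_fun_fubini_tonelli_F.
- by move=> w _; exact: integral_ge0.
Qed.

Let mind a : measurable_fun setT (\1_[set w | act w = a] : W -> R).
Proof. exact: measurable_indic. Qed.

Let ind0 a w : (0 <= (\1_[set w | act w = a] w : R))%R.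
Proof. by []. Qed.

(** The hypothesis [draw] is the equality on rectangles, a generating pi-system that contains the
    whole space, where the mass is finite. *)
Let draw_law a (S : set (WG * V)) : measurable S ->
  pushforward (density P (ind0 a) (mind a)) Phi S =
  pushforward (density P (fun w => q0 w (y w) a)
    (measurableT_comp (mq a) mPhi)) Phi S.
Proof.
move=> mS.
pose C : set (set (WG * V)) :=
  [set E `*` B | E in measurable & B in measurable].
have indE S' : measurable S' -> density P (ind0 a) (mind a) S' =
    P (S' `&` [set w | act w = a]).
  by move=> mS'; rewrite /density integral_indic// setIC.
apply: (measure_unique C (fun=> setT)) => //.
- exact: measurable_prod_measurableType.
- move=> _ _ [E1 mE1 [B1 mB1 <-]] [E2 mE2 [B2 mB2 <-]].
  exists (E1 `&` E2); first exact: measurableI.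
  by exists (B1 `&` B2); [exact: measurableI|rewrite setXI].
- by move=> _; exists setT => //; exists setT => //; exact: setXTT.
- by rewrite bigcup_const.
- move=> _ [E + [B mB <-]]; rewrite measurable_gen => GE.
  apply: etrans (indE (E `&` y @^-1` B) _) _; last exact: draw.
  apply: measurableI; first exact: GM.
  by rewrite -[X in measurable X]setTI; exact: my.
- move=> _; rewrite [ltLHS](indE setT measurableT) setTI.
  by rewrite (le_lt_trans (probability_le1 P _)) ?ltry.
Qed.

Lemma integral_draw (a : A) (f : WG * V -> \bar R) :
  measurable_fun setT f -> (forall z, 0 <= f z) ->
  \int[P]_w ((\1_[set w | act w = a] w)%:E * f (w, y w)) =
  \int[P]_w ((q w (y w) a)%:E * f (w, y w)).
Proof.
move=> mf f0.
have mfPhi : measurable_fun setT (f \o Phi) by exact: measurableT_comp mPhi.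
rewrite -(ge0_integral_density P (ind0 a) (mind a) mfPhi);
  last by move=> w; exact: f0.
rewrite -[LHS](ge0_integral_pushforward mPhi _ measurableT mf); last 1 first.
- by move=> z _.
transitivity (\int[pushforward (density P (fun w => q0 w (y w) a)
    (measurableT_comp (mq a) mPhi)) Phi]_z f z).
  by apply: eq_measure_integral => S mS _; exact: draw_law.
have fPhi0 w : 0 <= (f \o Phi) w by exact: f0.
rewrite (ge0_integral_pushforward mPhi _ measurableT mf); last by move=> z _.
exact: (ge0_integral_density P _ _ mfPhi).
Qed.

(** The tower rule with explicit conditional laws: [integral_draw] exchanges the indicator of each
    action for its probability, and [joint_law] integrates out the fresh pair. *)
Lemma one_round (f : A -> WG * V -> \bar R) :
  (forall a, measurable_fun setT (f a)) -> (forall a z, 0 <= f a z) ->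
  \int[P]_w f (act w) (w, y w) =
  \int[P]_w \int[D]_v \sum_(a : A) (q w v a)%:E * f a (w, v).
Proof.
move=> mf f0.
rewrite -(joint_law (f := fun z => \sum_(a : A) (q z.1 z.2 a)%:E * f a z))/=.
- rewrite ge0_integral_sum//.
  + under [RHS]eq_bigr do rewrite -integral_draw//.
    rewrite -ge0_integral_sum//.
    * apply: eq_integral => w _; rewrite (bigD1 (act w))//= indicE mem_set//.
      rewrite mul1e big1 ?adde0// => a aw; rewrite indicE memNset ?mul0e//=.
      by move=> /esym/eqP; rewrite (negbTE aw).
    * move=> a; apply: emeasurable_funM; first exact/measurable_EFinP.
      exact: measurableT_comp mPhi.
    * by move=> a w _; rewrite mule_ge0 ?lee_fin.
  + move=> a; apply: emeasurable_funM; last exact: measurableT_comp mPhi.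
    apply/measurable_EFinP; exact: measurableT_comp (mq a) mPhi.
  + by move=> a w _; rewrite mule_ge0 ?lee_fin.
- apply: emeasurable_sum => a; apply: emeasurable_funM => //.
  exact/measurable_EFinP.
- by move=> z; apply: sume_ge0 => a _; rewrite mule_ge0 ?lee_fin.
Qed.

End OneRound.

(** * Expectations of bounded functions and tail bounds *)

Section Expectation.
Context d (T : measurableType d) (R : realType) (P : probability T R).

Definition bounded_measurable (h : T -> R) : Prop :=
  measurable_fun setT h /\ exists M, forall x, `|h x| <= M.

Lemma bounded_integrable (h : T -> R) :
  bounded_measurable h -> P.-integrable setT (EFin \o h).
Proof.
move=> [mh [M hM]]; apply: measurable_bounded_integrable => //.
  by rewrite (le_lt_trans (probability_le1 P _)) ?ltry.
by exists M; split; [exact: num_real|move=> x xM y _;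
  exact: le_trans (hM y) (ltW xM)].
Qed.

Lemma bounded_measurable_cst (c : R) : bounded_measurable (fun=> c).
Proof. by split; [exact: measurable_cst|exists `|c|]. Qed.

Lemma bounded_measurableD (f g : T -> R) :
  bounded_measurable f -> bounded_measurable g ->
  bounded_measurable (fun x => f x + g x).
Proof.
move=> [mf [M fM]] [mg [N gN]]; split; first exact: measurable_funD.
by exists (M + N) => x; rewrite (le_trans (ler_normD _ _)) ?lerD.
Qed.

Lemma bounded_measurableM (f g : T -> R) :
  bounded_measurable f -> bounded_measurable g ->
  bounded_measurable (fun x => f x * g x).
Proof.
move=> [mf [M fM]] [mg [N gN]]; split; first exact: measurable_funM.
by exists (M * N) => x; rewrite normrM ler_pM.
Qed.

Lemma bounded_measurableZ (c : R) (f : T -> R) :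
  bounded_measurable f -> bounded_measurable (fun x => c * f x).
Proof. exact: bounded_measurableM (bounded_measurable_cst c). Qed.

Lemma bounded_measurableN (f : T -> R) :
  bounded_measurable f -> bounded_measurable (fun x => - f x).
Proof.
move=> [mf [M fM]]; split; first exact: measurableT_comp.
by exists M => x; rewrite normrN.
Qed.

Lemma bounded_measurable_sum (I : Type) (s : seq I) (f : I -> T -> R) :
  (forall i, bounded_measurable (f i)) ->
  bounded_measurable (fun x => \sum_(i <- s) f i x).
Proof.
move=> bf; elim: s => [|i s IH].
  by under eq_fun do rewrite big_nil; exact: bounded_measurable_cst.
by under eq_fun do rewrite big_cons; exact: bounded_measurableD.
Qed.

Definition Ex (h : T -> R) : R := \int[P]_x h x.

Lemma Ex_cst (c : R) : Ex (fun=> c) = c.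
Proof.
by rewrite /Ex Rintegral_cst// [X in fine X](probability_setT P) mulr1.
Qed.

Lemma ExD (f g : T -> R) : bounded_measurable f -> bounded_measurable g ->
  Ex (fun x => f x + g x) = Ex f + Ex g.
Proof. by move=> bf bg; apply: RintegralD => //; exact: bounded_integrable. Qed.

Lemma ExZ (c : R) (f : T -> R) : bounded_measurable f ->
  Ex (fun x => c * f x) = c * Ex f.
Proof. by move=> bf; apply: RintegralZl => //; exact: bounded_integrable. Qed.

Lemma ExN (f : T -> R) : bounded_measurable f ->
  Ex (fun x => - f x) = - Ex f.
Proof.
move=> bf; under [LHS]eq_Rintegral do rewrite -mulN1r.
by rewrite [LHS]ExZ// mulN1r.
Qed.

Lemma Ex_sum (I : Type) (s : seq I) (f : I -> T -> R) :
  (forall i, bounded_measurable (f i)) ->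
  Ex (fun x => \sum_(i <- s) f i x) = \sum_(i <- s) Ex (f i).
Proof.
move=> bf; elim: s => [|i s IH].
  rewrite big_nil -[RHS]Ex_cst; congr Ex.
  by apply/funext => x; rewrite big_nil.
rewrite big_cons -IH -ExD//; last exact: bounded_measurable_sum.
by congr Ex; apply/funext => x; rewrite big_cons.
Qed.

Lemma le_Ex (f g : T -> R) : bounded_measurable f -> bounded_measurable g ->
  (forall x, f x <= g x) -> Ex f <= Ex g.
Proof.
by move=> bf bg fg; apply: le_Rintegral => //; exact: bounded_integrable.
Qed.

Lemma EFin_Ex (f : T -> R) : bounded_measurable f ->
  (Ex f)%:E = (\int[P]_x (f x)%:E)%E.
Proof.
move=> bf; rewrite /Ex /Rintegral fineK//.
by apply: integrable_fin_num => //; exact: bounded_integrable.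
Qed.

Lemma measurable_set_lt (f g : T -> R) : measurable_fun setT f ->
  measurable_fun setT g -> measurable [set x | f x < g x].
Proof.
move=> mf mg; have := measurable_fun_ltr mf mg measurableT (Y := [set true]).
by rewrite setTI preimage_true; apply.
Qed.

Lemma measurable_set_le (f g : T -> R) : measurable_fun setT f ->
  measurable_fun setT g -> measurable [set x | f x <= g x].
Proof.
move=> mf mg; have := measurable_fun_ler mf mg measurableT (Y := [set true]).
by rewrite setTI preimage_true; apply.
Qed.

Lemma probability_markov_exp (L : T -> R) (e : R) : 0 < e ->
  measurable_fun setT L -> (\int[P]_x (expR (L x))%:E <= 1)%E ->
  (P [set x | (ln e^-1 < L x)%R] <= e%:E)%E.
Proof.
move=> e0 mL IL.
have mA : measurable [set x | (ln e^-1 < L x)%R].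
  by apply: measurable_set_lt => //; exact: measurable_cst.
have eV : e^-1 \is Num.pos by rewrite posrE invr_gt0.
have /le_trans/(_ IL) : (e^-1%:E * P [set x | (ln e^-1 < L x)%R] <=
    \int[P]_x (expR (L x))%:E)%E.
  rewrite -[X in P X]setIT -integral_indic// -ge0_integralZl//; last 2 first.
    - exact/measurable_EFinP/measurable_indic.
    - by rewrite lee_fin invr_ge0 ltW.
  apply: ge0_le_integral => //.
  - by move=> x _; apply: mule_ge0; rewrite lee_fin ?indicE// invr_ge0 ltW.
  - by apply/measurable_EFinP/measurable_funM => //; exact: measurable_indic.
  - exact/measurable_EFinP/measurableT_comp.
  - move=> x _; rewrite -EFinM lee_fin indicE.
    have [|] := boolP (x \in _); last by rewrite mulr0 expR_ge0.
    by rewrite inE/= mulr1 => lx; rewrite -[leLHS]lnK// ler_expR ltW.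
by rewrite lee_pdivrMl// mule1.
Qed.

Lemma probability_exists_le (I : finType) (B : I -> set T) (e : I -> R) :
  (forall i, measurable (B i)) -> (forall i, P (B i) <= (e i)%:E)%E ->
  measurable [set x | exists i, B i x] /\
  (P [set x | exists i, B i x] <= (\sum_i e i)%:E)%E.
Proof.
move=> mB Be.
suff H (s : seq I) : measurable [set x | exists2 i, i \in s & B i x] /\
    (P [set x | exists2 i, i \in s & B i x] <= (\sum_(i <- s) e i)%:E)%E.
  have := H (index_enum I).
  rewrite (_ : [set x | exists2 i, _ & _] = [set x | exists i, B i x])//.
  by apply/seteqP; split=> x [i]; exists i => //; rewrite mem_index_enum.
elim: s => [|i s [mS IH]].
  rewrite (_ : [set x | _] = set0) ?measure0 ?big_nil//.
  by apply/seteqP; split=> x // [].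
have -> : [set x | exists2 j, j \in i :: s & B j x] =
    B i `|` [set x | exists2 j, j \in s & B j x].
  apply/seteqP; split=> x.
    by case=> j; rewrite inE => /predU1P[->|js] Bj; [left|right; exists j].
  case=> [Bi|[j js Bj]]; first by exists i; rewrite ?mem_head.
  by exists j => //; rewrite inE js orbT.
split; first exact: measurableU.
apply: (le_trans (measureU2 _ _ _)) => //; rewrite big_cons EFinD.
by apply: leeD => //; exact: Be.
Qed.

End Expectation.

(** * Sparsification of a weight vector *)

Section RealInequalities.
Context {R : realType}.
Implicit Types x y a : R.

Lemma expR_le_inv_1B y : y < 1 -> expR y <= (1 - y)^-1.
Proof.
move=> y1; rewrite -[y]opprK expRN opprK lef_pV2 ?posrE ?expR_gt0 ?subr_gt0//.
exact: expR_ge1Dx.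
Qed.

(** Passing through [(1 - y)^-1] uses only [1 + x <= expR x]; the price is the constant 2 and the
    range [y <= 1/2], which is why the exponents below are kept at most 1/2. *)
Lemma expR_le_quadratic y : y <= 2^-1 -> expR y <= 1 + y + 2 * y ^+ 2.
Proof.
move=> y2; apply: le_trans (expR_le_inv_1B _) _; first lra.
rewrite -div1r ler_pdivrMr; last lra.
have -> : (1 + y + 2 * y ^+ 2) * (1 - y) = 1 + y ^+ 2 * (1 - 2 * y) by ring.
by rewrite lerDl mulr_ge0 ?sqr_ge0//; lra.
Qed.

Lemma expRN_le_1Bhalf y : 0 <= y <= 1 -> expR (- y) <= 1 - y / 2.
Proof.
move=> /andP[y0 y1]; apply: le_trans (expR_le_inv_1B _) _; first lra.
rewrite -div1r ler_pdivrMr; last lra.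
have -> : (1 - y / 2) * (1 - - y) = 1 + y * (1 - y) / 2 by field.
by rewrite lerDl divr_ge0// mulr_ge0//; lra.
Qed.

Lemma inv_ge_tangent y a : 0 < y -> 0 < a ->
  a^-1 - (y - a) / a ^+ 2 <= y^-1.
Proof.
move=> y0 a0; rewrite -subr_ge0.
have -> : y^-1 - (a^-1 - (y - a) / a ^+ 2) = (y - a) ^+ 2 / (a ^+ 2 * y).
  by field; rewrite !gt_eqF.
by rewrite divr_ge0 ?sqr_ge0// mulr_ge0 ?sqr_ge0// ltW.
Qed.

(** The exact error of the tangent is [(y - a)^2 / (a^2 y)]; for [1 <= y] the added square absorbs
    it. *)
Lemma inv_le_tangent_square y a : 1 <= y -> 0 < a ->
  y^-1 <= a^-1 - (y - a) / a ^+ 2 + (y - a) ^+ 2 / a ^+ 2.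
Proof.
move=> y1 a0; have y0 : 0 < y by lra.
rewrite -subr_ge0.
have -> : a^-1 - (y - a) / a ^+ 2 + (y - a) ^+ 2 / a ^+ 2 - y^-1 =
    (y - a) ^+ 2 * (y - 1) / (a ^+ 2 * y).
  by field; rewrite !gt_eqF.
by apply: divr_ge0; apply: mulr_ge0; rewrite ?sqr_ge0//; lra.
Qed.

End RealInequalities.

(* [iidE n f] is the expectation of [f] at [n] i.i.d. draws from [Q]. The
   two-sided bound on the mean of 1 / (1 + Bin(n, q)) uses only the first two
   moments: the tangent at the mean bounds 1/y from below, and adding the
   squared deviation bounds it from above. *)
Section IidExpectation.
Context {R : realType} {J : finType} (Q : J -> R).

Fixpoint iidE (n : nat) (f : seq J -> R) : R :=
  if n is n'.+1 then \sum_j Q j * iidE n' (fun s => f (j :: s)) else f [::].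

Lemma eq_iidE n f g : f =1 g -> iidE n f = iidE n g.
Proof.
elim: n f g => [|n IH] f g fg /=; first exact: fg.
by apply: eq_bigr => j _; congr (_ * _); apply: IH.
Qed.

Lemma iidED n f g : iidE n (fun s => f s + g s) = iidE n f + iidE n g.
Proof.
elim: n f g => [//|n IH] f g /=.
by rewrite -big_split/=; apply: eq_bigr => j _; rewrite IH mulrDr.
Qed.

Lemma iidEZ n c f : iidE n (fun s => c * f s) = c * iidE n f.
Proof.
elim: n f => [//|n IH] f /=.
by rewrite mulr_sumr; apply: eq_bigr => j _; rewrite IH mulrCA.
Qed.

Lemma iidE_sum n (I : Type) (r : seq I) (f : I -> seq J -> R) :
  iidE n (fun s => \sum_(i <- r) f i s) = \sum_(i <- r) iidE n (f i).
Proof.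
elim: r => [|i r IH].
  rewrite big_nil (@eq_iidE n _ (fun s => 0 * 0)) ?iidEZ ?mul0r// => s.
  exact: big_nil.
rewrite big_cons -IH -iidED; apply: eq_iidE => s; exact: big_cons.
Qed.

Context (Q0 : forall j, 0 <= Q j).
Lemma le_iidE n f g : (forall s, size s = n -> f s <= g s) ->
  iidE n f <= iidE n g.
Proof.
elim: n f g => [|n IH] f g fg /=; first exact: fg.
by apply: ler_sum => j _; rewrite ler_wpM2l// IH// => s sn; rewrite fg//= sn.
Qed.

Context (Q1 : \sum_j Q j = 1).
Lemma iidE_cst n c : iidE n (fun=> c) = c.
Proof. by elim: n => //= n ->; rewrite -mulr_suml Q1 mul1r. Qed.

(** The offset [a] serves the induction: the first draw is absorbed into it. *)
Lemma iidE_sum_centered n (c : J -> R) a : \sum_j Q j * c j = 0 ->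
  iidE n (fun s => a + \sum_(j <- s) c j) = a.
Proof.
move=> c0; elim: n a => [|n IH] a /=; first by rewrite big_nil addr0.
under eq_bigr => j _.
  rewrite (@eq_iidE n _ (fun s => (a + c j) + \sum_(j <- s) c j)); last first.
    by move=> s; rewrite big_cons addrA.
  rewrite IH mulrDr; over.
by rewrite big_split/= c0 addr0 -mulr_suml Q1 mul1r.
Qed.

Lemma iidE_sum_centered_sqr n (c : J -> R) a : \sum_j Q j * c j = 0 ->
  iidE n (fun s => (a + \sum_(j <- s) c j) ^+ 2) =
  a ^+ 2 + n%:R * \sum_j Q j * c j ^+ 2.
Proof.
move=> c0; elim: n a => [|n IH] a /=;
  first by rewrite big_nil addr0 mul0r addr0.
under eq_bigr => j _.
  rewrite (@eq_iidE n _ (fun s => ((a + c j) + \sum_(j <- s) c j) ^+ 2));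
    last first.
    by move=> s; rewrite big_cons addrA.
  rewrite IH.
  have -> : Q j * ((a + c j) ^+ 2 + n%:R * \sum_j Q j * c j ^+ 2) =
    Q j * (a ^+ 2 + n%:R * \sum_j Q j * c j ^+ 2) +
    ((2 * a) * (Q j * c j) + Q j * c j ^+ 2) by ring.
  over.
rewrite !big_split/= -mulr_suml Q1 -mulr_sumr c0 -natr1; ring.
Qed.

Section Inverse.
Context (B : pred J) (n : nat).
Let q := \sum_(j | B j) Q j.
Let c j : R := (B j)%:R - q.

Let c0 : \sum_j Q j * c j = 0.
Proof.
under eq_bigr do rewrite mulrBr.
rewrite sumrB -mulr_suml Q1 mul1r; apply/eqP; rewrite subr_eq0; apply/eqP.
by rewrite /q [RHS]big_mkcond; apply: eq_bigr => j _; case: (B j);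
  rewrite ?mulr1 ?mulr0.
Qed.

Let q0 : 0 <= q. Proof. exact: sumr_ge0. Qed.

Let cE s : size s = n ->
  1 + (count B s)%:R - (1 + n%:R * q) = 0 + \sum_(j <- s) c j.
Proof.
move=> <-; have -> : \sum_(j <- s) c j = (count B s)%:R - (size s)%:R * q.
  elim: s => [|j s IH]; first by rewrite big_nil mul0r subr0.
  by rewrite big_cons IH /= natrD -natr1 /c; ring.
ring.
Qed.

Lemma iidE_inv_ge :
  (1 + n%:R * q)^-1 <= iidE n (fun s => (1 + (count B s)%:R)^-1).
Proof.
have a0 : 0 < 1 + n%:R * q by rewrite ltr_pwDl// mulr_ge0.
set a := 1 + n%:R * q in a0 *.
apply: (@le_trans _ _ (iidE n (fun s => a^-1 +
    (- (a ^+ 2)^-1) * (0 + \sum_(j <- s) c j)))).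
  by rewrite iidED iidE_cst iidEZ iidE_sum_centered// mulr0 addr0.
apply: le_iidE => s sn; rewrite -cE// -/a mulrC mulrN.
by apply: inv_ge_tangent => //; rewrite ltr_pwDl.
Qed.

Lemma iidE_inv_le :
  iidE n (fun s => (1 + (count B s)%:R)^-1) <= 2 * (1 + n%:R * q)^-1.
Proof.
have a0 : 0 < 1 + n%:R * q by rewrite ltr_pwDl// mulr_ge0.
set a := 1 + n%:R * q in a0 *.
apply: (@le_trans _ _ (iidE n (fun s => (a^-1 +
    (- (a ^+ 2)^-1) * (0 + \sum_(j <- s) c j)) +
    (a ^+ 2)^-1 * (0 + \sum_(j <- s) c j) ^+ 2))).
  apply: le_iidE => s sn; rewrite -cE// -/a mulrC mulrN [_^-1 * _ ^+ 2]mulrC.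
  by apply: inv_le_tangent_square => //; rewrite lerDl.
rewrite !iidED iidE_cst !iidEZ iidE_sum_centered// iidE_sum_centered_sqr//.
have -> : \sum_j Q j * c j ^+ 2 = q * (1 - q).
  have qE : \sum_j Q j * (B j)%:R = q.
    rewrite /q [RHS]big_mkcond; apply: eq_bigr => j _.
    by case: (B j); rewrite ?mulr1 ?mulr0.
  under eq_bigr => j _.
    have -> : Q j * c j ^+ 2 = Q j * (B j)%:R * (1 - 2 * q) + Q j * q ^+ 2.
      by rewrite /c; case: (B j) => /=; ring.
    over.
  by rewrite big_split/= -!mulr_suml qE Q1; ring.
(* The variance [n q (1 - q)] is at most [a = 1 + n q], so the square contributes at most one
   further [a^-1]: this is the factor 2. *)
rewrite mulr0 expr0n/= add0r addr0 mulr2n mulrDl mul1r lerD2l.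
rewrite ler_pdivrMl ?exprn_gt0// exprSr -mulrA divff ?gt_eqF// mulr1.
rewrite /a; have : 0 <= n%:R * q ^+ 2 by rewrite mulr_ge0 ?sqr_ge0.
by move=> ?; lra.
Qed.

End Inverse.
End IidExpectation.

(** * Epochs and minimum probabilities *)

(** With rounds counted from 0, round [t] uses the weights of index [epochs_done tau t]. The lower
    bound says that they depend on the first [t] rounds only, hence are predictable. *)
Lemma epochs_doneP (tau : nat -> nat) (t : nat) : epoch_schedule tau ->
  (tau (epochs_done tau t) <= t < tau (epochs_done tau t).+1)%N.
Proof.
move=> [tau0 tauS _]; elim: t => [|t /andP[IH1 IH2]].
  by rewrite /= tau0 leqnn/=; have := tauS 0%N; rewrite tau0.
rewrite /=; case: eqP => [->|/eqP ne]; first by rewrite leqnn tauS.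
by rewrite (leq_trans IH1)//= ltn_neqAle ne.
Qed.

Lemma epoch_schedule_ge (tau : nat -> nat) m : epoch_schedule tau ->
  (m <= tau m)%N.
Proof.
move=> [tau0 tauS _]; elim: m => [//|m IH].
exact: leq_ltn_trans IH (tauS m).
Qed.

Lemma epoch_schedule_mono (tau : nat -> nat) : epoch_schedule tau ->
  {mono tau : i j / (i <= j)%N}.
Proof.
move=> [_ tauS _]; apply: leq_mono; apply: homo_ltn tauS; exact: ltn_trans.
Qed.

Lemma epochs_done_lt (tau : nat -> nat) t m : epoch_schedule tau ->
  (t < tau m)%N -> (epochs_done tau t < m)%N.
Proof.
move=> sched tm; have /andP[le1 _] := epochs_doneP t sched.
by rewrite ltnNge -(epoch_schedule_mono sched) -ltnNge (leq_ltn_trans le1).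
Qed.

Section MinProb.
Context {R : realType}.
Context (K N : nat) (delta : R) (tau : nat -> nat).
Context (K0 : (0 < K)%N) (N0 : (0 < N)%N) (delta01 : 0 < delta < 1).
Context (sched : epoch_schedule tau).
Definition log_term (t : nat) : R := ln (16 * t%:R ^+ 2 * N%:R / delta).

Local Notation mu := (min_prob K N delta tau).
Local Notation d m := (log_term (tau m)).

Let K0' : 0 < K%:R :> R. Proof. by rewrite ltr0n. Qed.

Let N1 : 1 <= N%:R :> R. Proof. by rewrite ler1n. Qed.

Lemma log_arg_ge16 t : (0 < t)%N -> 16 <= 16 * t%:R ^+ 2 * N%:R / delta :> R.
Proof.
move=> t0; have /andP[d0 d1] := delta01.
have t1 : 1 <= t%:R ^+ 2 :> R by rewrite exprn_ege1// ler1n.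
rewrite ler_pdivlMr// (@le_trans _ _ 16)//; first by rewrite ler_piMr// ltW.
by rewrite -mulrA ler_peMr// mulr_ege1.
Qed.

Lemma ln2_gt_half : 2^-1 < ln 2 :> R.
Proof.
rewrite -ltr_expR lnK ?posrE// -[ltLHS]invrK -expRN invf_plt ?posrE ?expR_gt0//.
have {1}-> : 2^-1 = 1 + - 2^-1 :> R by field.
by apply: expR_gt1Dx; rewrite oppr_eq0 invr_eq0.
Qed.

Lemma ln16_gt2 : 2 < ln 16 :> R.
Proof.
have -> : 16 = 2 ^+ 4 :> R by rewrite -natrX.
by rewrite lnXn//; have := ln2_gt_half; lra.
Qed.

Lemma log_term_gt2 t : (0 < t)%N -> 2 < log_term t.
Proof.
move=> t0; apply: lt_le_trans ln16_gt2 _.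
by rewrite ler_ln ?posrE ?(lt_le_trans _ (log_arg_ge16 t0))// log_arg_ge16.
Qed.

(** [ln (C t^2) / t] decreases once [ln (C t^2) >= 2], which the constant 16 guarantees from the
    first round on; [ln r <= r - 1] replaces the derivative. *)
Lemma log_term_div_noninc (s t : nat) : (0 < s)%N -> (s <= t)%N ->
  log_term t / t%:R <= log_term s / s%:R.
Proof.
move=> s0 st; have t0 := leq_trans s0 st.
have s0' : 0 < s%:R :> R by rewrite ltr0n.
have t0' : 0 < t%:R :> R by rewrite ltr0n.
have /andP[d0 _] := delta01.
pose r : R := t%:R / s%:R.
have r0 : 0 < r by rewrite divr_gt0.
have r1 : 1 <= r by rewrite ler_pdivlMr// mul1r ler_nat.
have -> : log_term t = log_term s + ln r *+ 2.
  rewrite -lnXn// -lnM ?posrE ?exprn_gt0//; last first.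
    exact: lt_le_trans (log_arg_ge16 s0).
  by congr ln; rewrite /r; field; rewrite !gt_eqF.
rewrite ler_pdivrMr// mulrAC -mulrA -/r.
have := log_term_gt2 s0.
have lnr : ln r <= r - 1.
  have := @le_ln1Dx _ (r - 1).
  by rewrite (_ : 1 + (r - 1) = r); [apply; lra|ring].
rewrite mulr2n; nra.
Qed.

Lemma min_prob_gt0 m : 0 < mu m.
Proof.
case: m => [|m] /=; first by rewrite divr_gt0 ?mulr_gt0.
have tm : (0 < tau m.+1)%N
  by rewrite (leq_trans _ (epoch_schedule_ge m.+1 sched)).
rewrite lt_min divr_gt0 ?mulr_gt0//= sqrtr_gt0 divr_gt0 ?mulr_gt0 ?ltr0n//.
by rewrite (lt_trans _ (log_term_gt2 tm)).
Qed.

Lemma min_prob_le m : mu m <= 1 / (2 * K%:R).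
Proof. by case: m => [//|m]; rewrite /= ge_min lexx. Qed.

Lemma min_prob_sqr_le m : (0 < m)%N -> mu m ^+ 2 <= d m / (K%:R * (tau m)%:R).
Proof.
case: m => [//|m] _.
have tm : (0 < tau m.+1)%N
  by rewrite (leq_trans _ (epoch_schedule_ge m.+1 sched)).
have x0 : 0 <= d m.+1 / (K%:R * (tau m.+1)%:R).
  by rewrite divr_ge0 ?mulr_ge0// ltW// (lt_trans _ (log_term_gt2 tm)).
rewrite -[leRHS]sqr_sqrtr//.
rewrite lerXn2r ?nnegrE ?sqrtr_ge0 ?(ltW (min_prob_gt0 _))//.
by rewrite /= ge_min lexx orbT.
Qed.

(** Below the cap the square root is attained, so the logarithm can be exchanged for [K tau mu^2].
    This is the form in which the tail bounds are read later. *)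
Lemma min_prob_small m : mu m < 1 / (2 * K%:R) ->
  (0 < m)%N /\ d m = K%:R * (tau m)%:R * mu m ^+ 2.
Proof.
case: m => [|m]; first by rewrite /= ltxx.
move=> small; split=> //.
have tm : (0 < tau m.+1)%N
  by rewrite (leq_trans _ (epoch_schedule_ge m.+1 sched)).
have x0 : 0 <= d m.+1 / (K%:R * (tau m.+1)%:R).
  by rewrite divr_ge0 ?mulr_ge0// ltW// (lt_trans _ (log_term_gt2 tm)).
have -> : mu m.+1 = Num.sqrt (d m.+1 / (K%:R * (tau m.+1)%:R)).
  by move: small; rewrite /= /Num.min; case: ifP => // _; rewrite ltxx.
rewrite sqr_sqrtr// mulrC divfK// mulf_neq0// ?gt_eqF// ltr0n//.
Qed.

Lemma min_prob_noninc i j : (i <= j)%N -> mu j <= mu i.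
Proof.
case: i => [_|i]; first exact: min_prob_le.
case: j => [//|j] ij; rewrite /= le_min ge_min lexx/= ge_min; apply/orP; right.
rewrite ler_sqrt; last first.
  rewrite divr_ge0 ?mulr_ge0// ltW// (lt_trans _ (log_term_gt2 _))//.
  by rewrite (leq_trans _ (epoch_schedule_ge i.+1 sched)).
have kE (x y : R) : x / (K%:R * y) = K%:R^-1 * (x / y) by rewrite invfM mulrCA.
rewrite !kE ler_pM2l ?invr_gt0//; apply: log_term_div_noninc.
  by rewrite (leq_trans _ (epoch_schedule_ge i.+1 sched)).
by rewrite (epoch_schedule_mono sched).
Qed.

End MinProb.

(** * Deterministic part of the argument *)

(** What holds for one outcome outside the exceptional event is taken as hypotheses, so the
    induction is free of probability. [risk] is an expected reward (larger is better), [V k] the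
    expectation of [1/Q^mu] in epoch [k], and [Vbar m] its average over the rounds before the end of
    epoch [m]. *)
Section EpochInduction.
Context {R : realType} {Pi : Type}.
Context (K : R) (mu : nat -> R) (risk : Pi -> R) (Rh : nat -> Pi -> R).
Context (lead : nat -> Pi) (V Vbar : nat -> Pi -> R) (pistar : Pi) (T : nat).
Context (K0 : 0 < K) (mu0 : forall m, 0 < mu m).
Context (mu_noninc : forall i j, (i <= j)%N -> mu j <= mu i).
Context (small_gt0 : forall m, mu m < 1 / (2 * K) -> (0 < m)%N).
Context (risk_le : forall p, risk p <= risk pistar).
Context (leadP : forall m p, Rh m p <= Rh m (lead m)).
Context (Vbar_le : forall m p c, (0 < m)%N ->
  (forall k, (k < m)%N -> V k p <= c) -> Vbar m p <= c).
Context (dev : forall m p, (m <= T)%N -> mu m < 1 / (2 * K) ->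
  `|Rh m p - risk p| <= mu m * Vbar m p + 2 * (K * mu m)).
Context (var : forall k p, (k <= T)%N -> mu k < 1 / (2 * K) ->
  V k p <= 48 * K + 16 * ((Rh k (lead k) - Rh k p) / (100 * mu k))).
Context (V_le : forall k p, V k p <= (mu k)^-1).
Local Notation gap p := (risk pistar - risk p).
Local Notation emp_gap m p := (Rh m (lead m) - Rh m p).

(* The induction closes because [16 * 2 / 100 < 1 / 2]: 16 is the factor lost
   between the true and the empirical variance, 100 is [psi]. *)
Lemma gap_comparison m p : (m <= T)%N -> mu m < 1 / (2 * K) ->
  gap p <= 2 * emp_gap m p + 600 * (K * mu m) /\
  emp_gap m p <= 2 * gap p + 600 * (K * mu m).
Proof.
have [n] := ubnP m; elim: n => [//|n IH] in m p * => mn mT sm.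
have m0 := small_gt0 sm.
have muE := mu0 m.
have Kmu : 0 < K * mu m by rewrite mulr_gt0.
(* The induction hypothesis divided by [100 * mu k] gives [1/50] of the gap and [6 K]. Hence
   [8/25 = 16/50] and [144 = 48 + 16 * 6]; [dev] adds the remaining 2. *)
have devE q : `|Rh m q - risk q| <= 146 * (K * mu m) + 8 / 25 * gap q.
  have gq : 0 <= gap q by rewrite subr_ge0.
  suff /(ler_wpM2l (ltW muE)) : Vbar m q <= 144 * K + 8 / 25 * (gap q / mu m).
    have -> : mu m * (144 * K + 8 / 25 * (gap q / mu m)) =
      144 * (K * mu m) + 8 / 25 * gap q by field; rewrite gt_eqF.
    by have := dev q mT sm; lra.
  apply: Vbar_le => // k km; have muk := mu0 k.
  have gm : gap q / mu k <= gap q / mu m.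
    by rewrite ler_wpM2l// lef_pV2 ?posrE// mu_noninc// ltnW.
  have gm0 : 0 <= gap q / mu m by rewrite divr_ge0// ltW.
  set g := gap q / mu m in gm gm0 *.
  have K0' := K0.
  have [sk|] := ltP (mu k) (1 / (2 * K)); last first.
    (* In an epoch at the cap the trivial bound [1 / mu k <= 2 K] suffices without an induction
       hypothesis; such epochs are the base case. *)
    move=> lk; apply: le_trans (V_le k q) _.
    have : (mu k)^-1 <= 2 * K.
      by rewrite -[leRHS]invrK lef_pV2 ?posrE ?invr_gt0 ?mulr_gt0// -div1r.
    by lra.
  have kT : (k <= T)%N by rewrite (leq_trans _ mT)// ltnW.
  have [_ h] := IH k q (leq_trans km (mn : (m <= n)%N)) kT sk.
  apply: le_trans (var q kT sk) _.
  have : emp_gap k q / (100 * mu k) <= 1 / 50 * (gap q / mu k) + 6 * K.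
    rewrite ler_pdivrMr ?mulr_gt0//.
    have -> : (1 / 50 * (gap q / mu k) + 6 * K) * (100 * mu k) =
      2 * gap q + 600 * (K * mu k) by field; rewrite gt_eqF.
    exact: h.
  by lra.
have gp : 0 <= gap p by rewrite subr_ge0.
have gl : 0 <= gap (lead m) by rewrite subr_ge0.
have ep : 0 <= emp_gap m p by rewrite subr_ge0.
have es : 0 <= emp_gap m pistar by rewrite subr_ge0.
(* [pistar] has gap 0, and the share [8/25] of the leader's gap is absorbed by that gap itself. What
   remains is [8/25 < 1/2] of the gap of [p], whence the factor 2, and [2 * 146], whose double is
   below 600. *)
have := devE p; have := devE (lead m); have := devE pistar.
rewrite subrr !ler_norml => /andP[a1 a2] /andP[b1 b2] /andP[c1 c2].
by split; lra.
Qed.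

End EpochInduction.

(** * Scalar inequalities for the one-round estimates and the final summation *)

Section FinalBounds.
Context {R : realType}.

Lemma sum_invsqrt_le (T : nat) :
  \sum_(t < T) (Num.sqrt t.+1%:R)^-1 <= 2 * Num.sqrt T%:R :> R.
Proof.
elim: T => [|T IH]; first by rewrite big_ord0 sqrtr0 mulr0.
rewrite big_ord_recr/=;
  apply: (@le_trans _ _ (2 * Num.sqrt T%:R + (Num.sqrt T.+1%:R)^-1)).
  by rewrite lerD2r.
set x : R := Num.sqrt T%:R; set y : R := Num.sqrt T.+1%:R.
have y0 : 0 < y by rewrite sqrtr_gt0 ltr0n.
have x0 : 0 <= x by exact: sqrtr_ge0.
have x2 : x ^+ 2 = T%:R by rewrite sqr_sqrtr.
have y2 : y ^+ 2 = x ^+ 2 + 1 by rewrite x2 sqr_sqrtr// natr1.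
rewrite -lerBrDl -div1r ler_pdivrMr//.
by have := sqr_ge0 (y - x); nra.
Qed.

(** [l] is the scale of the tail bound for the regret: up to constants it minimizes [2 l T + L / l],
    cut at 1/2 to keep the exponent small. Where the cut is active, [T <= 4 L] and everything is of
    order [L]. *)
Lemma sqrt_min_tradeoff (T L : R) : 1 <= T -> 0 < L ->
  let l := Num.min 2^-1 (Num.sqrt (L / T)) in
  0 < l <= 2^-1 /\ 2 * l * T + L / l <= 3 * Num.sqrt (T * L) + 6 * L.
Proof.
move=> T1 L0 l; have T0 : 0 < T by lra.
set s := Num.sqrt (L / T).
have s0 : 0 < s by rewrite sqrtr_gt0 divr_gt0.
have l0 : 0 < l by rewrite lt_min s0 andbT invr_gt0.
split; first by rewrite l0 ge_min lexx.
have s2 : s ^+ 2 = L / T by rewrite sqr_sqrtr// divr_ge0 ?ltW.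
have LE : L = s ^+ 2 * T by rewrite s2 divfK// gt_eqF.
have TL : Num.sqrt (T * L) = s * T.
  have -> : T * L = (s * T) ^+ 2 by rewrite LE; ring.
  by rewrite sqrtr_sqr ger0_norm// mulr_ge0 ?ltW.
rewrite TL; have [hs|hs] := leP s 2^-1.
  have -> : l = s by rewrite /l min_r.
  have -> : L / s = s * T by rewrite LE; field; rewrite gt_eqF.
  by lra.
have -> : l = 2^-1 by rewrite /l min_l// ltW.
have : T <= 4 * L.
  have s1 : 1 <= 4 * s ^+ 2 by nra.
  by rewrite LE mulrA ler_peMl// ltW.
have : 0 < s * T by rewrite mulr_gt0.
by rewrite invrK; lra.
Qed.

End FinalBounds.

Lemma indic_eqE (R : realType) (T : Type) (U : eqType) (f : T -> U) (a : U) :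
  \1_[set w | f w = a] = (fun w => (f w == a)%:R) :> (T -> R).
Proof.
apply/funext => w; rewrite indicE; congr ((nat_of_bool _)%:R).
by apply/idP/idP; rewrite inE => /eqP.
Qed.

Lemma measurable_invr_gt0 d (T : measurableType d) (R : realType) (f : T -> R) :
  measurable_fun setT f -> (forall x, 0 < f x) ->
  measurable_fun setT (fun x => (f x)^-1).
Proof.
move=> mf f0; rewrite (_ : (fun x => _) = (fun x => expR (- ln (f x)))).
  apply: measurableT_comp => //; apply: measurableT_comp => //.
  exact: measurableT_comp (@measurable_ln R) mf.
by apply/funext => x; rewrite expRN lnK// posrE.
Qed.

Lemma sqr_eq1_le1 (R : realFieldType) (s : R) : s ^+ 2 = 1 -> s <= 1.
Proof. by move=> ?; nra. Qed.

Lemma regret_exp_le (R : realType) (l x r : R) : 0 <= l -> l <= 2^-1 ->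
  0 <= x <= 1 -> 0 <= r <= 1 ->
  expR (l * (x - r)) <= 1 + 2 * l ^+ 2 + l * (x - r).
Proof.
move=> l0 l2 /andP[x0 x1] /andP[r0 r1].
have y1 : x - r <= 1 by lra.
have y2 : -1 <= x - r by lra.
apply: le_trans (expR_le_quadratic _) _; first by nra.
have : (x - r) ^+ 2 <= 1 by nra.
by rewrite exprMn; have := sqr_ge0 l; nra.
Qed.

(** Uniform exploration has total mass [K m]. It adds at most [l * K m] directly, and withdrawing
    that mass from [S] costs at most as much again because [S >= -1]. *)
Lemma regret_mix_le (R : realFieldType) (m K l S F : R) :
  0 <= m -> 0 <= K * m -> 0 <= l -> -1 <= S ->
  F <= K * (1 + 2 * l ^+ 2 + l) ->
  (1 - K * m) * (1 + 2 * l ^+ 2 + l * S) + m * F <=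
  1 + ((2 * l ^+ 2 + l * (2 * (K * m))) + l * S).
Proof.
move=> m0 Km0 l0 S1 FK.
have h1 : m * F <= K * m * (1 + 2 * l ^+ 2 + l).
  by rewrite mulrAC [leRHS]mulrC ler_wpM2l.
have h2 : 0 <= (K * m) * l * (1 + S) by apply: mulr_ge0; [exact: mulr_ge0|lra].
by rewrite -subr_ge0; nra.
Qed.

Lemma sum_inv_sqr_le2 (R : realFieldType) (n : nat) :
  \sum_(m < n) (m.+1%:R ^+ 2)^-1 <= 2 :> R.
Proof.
case: n => [|n]; first by rewrite big_ord0.
suff : \sum_(m < n.+1) (m.+1%:R ^+ 2)^-1 <= 2 - n.+1%:R^-1 :> R.
  by move=> /le_trans; apply; rewrite gerBl invr_ge0.
elim: n => [|n IH]; first by rewrite big_ord1 expr1n invr1; lra.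
rewrite big_ord_recr/=; set x : R := n.+1%:R in IH *.
have x0 : 0 < x by rewrite ltr0n.
have -> : n.+2%:R = x + 1 :> R by rewrite natr1.
apply: (@le_trans _ _ (2 - x^-1 + ((x + 1) ^+ 2)^-1)); first by rewrite lerD2r.
rewrite -subr_ge0.
have -> : 2 - (x + 1)^-1 - (2 - x^-1 + ((x + 1) ^+ 2)^-1) =
  (x * (x + 1) ^+ 2)^-1.
  by field; rewrite !gt_eqF// addr_gt0.
by rewrite invr_ge0 mulr_ge0 ?sqr_ge0// ltW.
Qed.

Section Step.
Context d (V : measurableType d) (R : realType) (D : probability V R).
Context (G0 : set V).
Context (mG0 : measurable G0) (G01 : D G0 = 1%E).

Let DC0 : D (~` G0) = 0%E.
Proof. by rewrite probability_setC// G01 subee. Qed.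

(** The common end of the three one-round estimates: [Phi] has mean at most [1 + c <= expR c]. Off
    the full-measure set [G0] the function [Phi] is uncontrolled and possibly unbounded, so both
    integrals are restricted to [G0] before they are compared. *)
Lemma integral_exp_step (Phi h : V -> R) (c : R) :
  measurable_fun setT Phi -> (forall v, 0 <= Phi v) -> bounded_measurable h ->
  (forall v, G0 v -> Phi v <= 1 + h v) -> Ex D h <= c ->
  (\int[D]_v (expR (- c) * Phi v)%:E <= 1)%E.
Proof.
move=> mPhi Phi0 bh Phih hc.
under eq_integral do rewrite EFinM.
rewrite ge0_integralZl//; last 2 first.
  - exact/measurable_EFinP.
  - by move=> v _; rewrite lee_fin.
have b1h : bounded_measurable (fun v => 1 + h v).
  by apply: bounded_measurableD => //; exact: bounded_measurable_cst.
suff : (\int[D]_v (Phi v)%:E <= (1 + c)%:E)%E.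
  move=> le1; apply: (@le_trans _ _ ((expR (- c))%:E * (expR c)%:E)%E).
    apply: lee_wpmul2l; first by rewrite lee_fin expR_ge0.
    by rewrite (le_trans le1)// lee_fin expR_ge1Dx.
  by rewrite -EFinM -expRD addNr expR0.
apply: (@le_trans _ _ (\int[D]_v (1 + h v)%:E)%E); last first.
  rewrite -EFin_Ex// lee_fin ExD//; last exact: bounded_measurable_cst.
  by rewrite Ex_cst lerD2l.
rewrite (ge0_negligible_integral (measurableC mG0) _ _ _ DC0)//; last 2 first.
  - exact/measurable_EFinP.
  - by move=> v _; rewrite lee_fin.
rewrite [leRHS](negligible_integral (measurableC mG0) _ _ DC0)//; last first.
  exact: bounded_integrable.
rewrite setTD setCK; apply: ge0_le_integral => //.
- by move=> v _; rewrite lee_fin.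
- exact/measurable_EFinP/measurable_funTS.
- by apply/measurable_EFinP/measurable_funTS; case: b1h.
Qed.

End Step.

(** * Runs of the algorithm *)

Section Run.
Context (R : realType) d (X : measurableType d) (A : finType).
Context (Pi : {fset (X -> A)}) (D : probability (X * rewards R A)%type R).
Context (delta : R) (tau : nat -> nat).
Context d' (Omega : measurableType d') (P : probability Omega R).
Context (F : nat -> set (set Omega)) (Z : Omega -> trajectory R Pi).
Context (mPi : measurable_policies Pi) (rD : reward_distribution D).
Context (delta01 : 0 < delta < 1) (sched : epoch_schedule tau).
Context (run : ilovetoconbandits_run D delta tau P F Z).
Local Notation XR := (X * rewards R A)%type.
Local Notation OF t := (g_sigma_algebraType (F t)).
Local Notation mu k := (@mu_ R X A Pi delta tau k).

(* Rounds are counted from 0 from here on: [obs t] and [draw t] belong to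
   round [t.+1] of the trajectory. *)
Definition obs (t : nat) (w : Omega) : XR := (ctx (Z w) t.+1, rwd (Z w) t.+1).

Definition draw (t : nat) (w : Omega) : A := act (Z w) t.+1.

Definition aprob (k : nat) (w : Omega) (x : X) (a : A) : R :=
  smoothed (completed (wgt (Z w) k) (ldr (Z w) (tau k))) (mu k) a x.

Lemma filtration_sigma_algebra t : sigma_algebra setT (F t).
Proof. by case: (run_filtration run). Qed.

Lemma filtration_measurable t : F t `<=` measurable.
Proof. by case: (run_filtration run). Qed.

Lemma filtration_le s t : (s <= t)%N -> F s `<=` F t.
Proof.
move=> /subnKC <-; elim: (t - s)%N => [|n IH]; first by rewrite addn0.
case: (run_filtration run) => _ _ FS.
by rewrite addnS; exact: subset_trans IH (FS _).
Qed.

Lemma measurable_OF t (E : set (OF t)) : measurable E = F t E.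
Proof. exact: (measurable_gen (filtration_sigma_algebra t)). Qed.

Lemma measurable_OF_le s t dU (U : measurableType dU) (f : Omega -> U) :
  (s <= t)%N -> measurable_fun setT (f : OF s -> U) ->
  measurable_fun setT (f : OF t -> U).
Proof.
move=> st mf _ B mB; rewrite setTI measurable_OF; apply: (filtration_le st).
by rewrite -measurable_OF -[X in measurable X]setTI; exact: mf.
Qed.

Lemma measurable_OF_Omega t dU (U : measurableType dU) (f : Omega -> U) :
  measurable_fun setT (f : OF t -> U) -> measurable_fun setT f.
Proof.
move=> mf _ B mB; rewrite setTI; apply: (@filtration_measurable t).
by rewrite -measurable_OF -[X in measurable X]setTI; exact: mf.
Qed.

Lemma measurable_obs t : measurable_fun setT (obs t : OF t.+1 -> XR).
Proof.
move=> _ B mB; rewrite setTI measurable_OF.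
exact: (run_adapted_data run t).
Qed.

Lemma measurable_draw t a :
  measurable_fun setT ((fun w => (draw t w == a)%:R) : OF t.+1 -> R).
Proof.
have mE : measurable ([set w | draw t w = a] : set (OF t.+1)).
  by rewrite measurable_OF; exact: (run_adapted_act run t a).
by rewrite -indic_eqE; exact: measurable_indic.
Qed.

Lemma measurable_ldr t p :
  measurable_fun setT ((fun w => (ldr (Z w) t == p)%:R) : OF t -> R).
Proof.
have mE : measurable ([set w | ldr (Z w) t = p] : set (OF t)).
  by rewrite measurable_OF; exact: (run_adapted_ldr run t p).
by rewrite -indic_eqE; exact: measurable_indic.
Qed.

Lemma measurable_wgt m p :
  measurable_fun setT ((fun w => wgt (Z w) m p) : OF (tau m) -> R).
Proof.
move=> _ B mB; rewrite setTI measurable_OF.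
exact: (run_adapted_wgt run m p).
Qed.

Lemma measurable_policy_eq (p : Pi) a :
  measurable_fun setT (fun x : X => (val p x == a)%:R : R).
Proof.
by rewrite -indic_eqE; exact: measurable_indic (mPi p a).
Qed.

Lemma measurable_reward a : measurable_fun setT (fun v : XR => reward v.2 a).
Proof.
apply: (@measurableT_comp _ _ _ _ _ _ (fun r : rewards R A => reward r a)).
  exact: measurable_tnth.
exact: measurable_snd.
Qed.

Definition weights k w : Pi -> R := completed (wgt (Z w) k) (ldr (Z w) (tau k)).

Lemma measurable_weights k p :
  measurable_fun setT ((fun w => weights k w p) : OF (tau k) -> R).
Proof.
apply: measurable_funD; first exact: measurable_wgt.
apply: measurable_funM.
  apply: measurable_funB; first exact: measurable_cst.
  by apply: measurable_sum => q; exact: measurable_wgt.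
by under eq_fun do rewrite eq_sym; exact: measurable_ldr.
Qed.

Lemma aprobE k w x a : aprob k w x a =
  (1 - #|A|%:R * mu k) * \sum_p weights k w p * (val p x == a)%:R + mu k.
Proof.
rewrite /aprob /smoothed /action_weight; congr (_ * _ + _).
rewrite big_mkcond; apply: eq_bigr => p _.
by case: eqP; rewrite ?mulr1 ?mulr0.
Qed.

Lemma measurable_aprob k t a : (tau k <= t)%N ->
  measurable_fun setT (fun z : OF t * XR => aprob k z.1 z.2.1 a).
Proof.
move=> kt; under eq_fun do rewrite aprobE.
apply: measurable_funD; last exact: measurable_cst.
apply: measurable_funM; first exact: measurable_cst.
apply: measurable_sum => p; apply: measurable_funM.
  apply: (@measurableT_comp _ _ _ _ _ _ ((fun w => weights k w p) : OF t -> R)).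
    exact: (measurable_OF_le kt (@measurable_weights k p)).
  exact: measurable_fst.
apply: (@measurableT_comp _ _ _ _ _ _ (fun x : X => (val p x == a)%:R : R)).
  exact: measurable_policy_eq.
exact: measurableT_comp measurable_fst measurable_snd.
Qed.

Lemma card_act_gt0 : (0 < #|A|)%N.
Proof. by apply/card_gt0P; exists (act (Z point) 0). Qed.

Lemma card_policies_gt0 : (0 < #|` Pi|)%N.
Proof. by rewrite cardfE; apply/card_gt0P; exists (ldr (Z point) 0). Qed.

Lemma mu_gt0 k : 0 < mu k.
Proof. exact: min_prob_gt0 card_act_gt0 card_policies_gt0 delta01 sched k. Qed.

Lemma Kmu_le k : #|A|%:R * mu k <= 2^-1.
Proof.
have K0 : 0 < #|A|%:R :> R by rewrite ltr0n card_act_gt0.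
rewrite -ler_pdivlMl// -invfM mulrC -div1r.
exact: min_prob_le.
Qed.

Lemma wgt_subdistribution k w : subdistribution (wgt (Z w) k).
Proof.
case: (run_updates run w) => _ w0 wS; case: k => [|k]; last by case: (wS k.+1).
split; first by move=> p; rewrite w0.
by rewrite big1.
Qed.

Lemma wgt_le_weights k w p : wgt (Z w) k p <= weights k w p.
Proof.
have [w0 w1] := wgt_subdistribution k w.
by rewrite /weights /completed lerDl mulr_ge0// subr_ge0.
Qed.

Lemma weights_ge0 k w p : 0 <= weights k w p.
Proof.
have [w0 w1] := wgt_subdistribution k w.
exact: le_trans (w0 p) (wgt_le_weights k w p).
Qed.

Lemma weights_sum1 k w : \sum_p weights k w p = 1.
Proof.
rewrite /weights /completed big_split/= -mulr_sumr.
rewrite [X in _ * X](_ : _ = 1) ?mulr1 1?addrC ?subrK//.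
rewrite (bigD1 (ldr (Z w) (tau k)))//= eqxx big1 ?addr0//.
by move=> p /negbTE ->.
Qed.

Lemma aprob_ge_mu k w x a : mu k <= aprob k w x a.
Proof.
rewrite aprobE lerDr mulr_ge0//.
  by have := Kmu_le k; lra.
by apply: sumr_ge0 => p _; rewrite mulr_ge0// weights_ge0.
Qed.

Lemma aprob_gt0 k w x a : 0 < aprob k w x a.
Proof. exact: lt_le_trans (mu_gt0 k) (aprob_ge_mu k w x a). Qed.

Lemma sum_aprob k w x (f : A -> R) : \sum_a aprob k w x a * f a =
  (1 - #|A|%:R * mu k) * \sum_p weights k w p * f (val p x) +
  mu k * \sum_a f a.
Proof.
under eq_bigr do rewrite aprobE mulrDl.
rewrite big_split/= -mulr_sumr; congr (_ + _).
under eq_bigr do rewrite -mulrA mulr_suml.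
rewrite -mulr_sumr exchange_big/=; congr (_ * _); apply: eq_bigr => p _.
rewrite (bigD1 (val p x))//= eqxx mulr1 big1 ?addr0// => a.
by rewrite eq_sym => /negbTE ->; rewrite mulr0 mul0r.
Qed.

Lemma sum_aprob1 k w x : \sum_a aprob k w x a = 1.
Proof.
rewrite (eq_bigr (fun a => aprob k w x a * 1));
  last by move=> a _; rewrite mulr1.
rewrite sum_aprob; under eq_bigr do rewrite mulr1.
by rewrite weights_sum1 sumr_const -[1 *+ _]/(#|A|%:R); ring.
Qed.

(** * Exponential supermartingales along a run *)

Definition path_sum (g : nat -> Omega -> XR -> A -> R) (n : nat)
    (w : Omega) : R :=
  \sum_(t < n) g t w (obs t w) (draw t w).

(** The past enters through [F t] only, while the fresh pair and the action are free arguments; this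
    is the form to which [one_round] applies. *)
Definition adapted (g : nat -> Omega -> XR -> A -> R) : Prop :=
  forall t a, measurable_fun setT (fun z : OF t * XR => g t z.1 z.2 a).

Lemma measurable_path_sum g n : adapted g ->
  measurable_fun setT (path_sum g n : OF n -> R).
Proof.
move=> ag; elim: n => [|n IH].
  rewrite (_ : path_sum g 0 = fun=> 0); first exact: measurable_cst.
  by apply/funext => w; rewrite /path_sum big_ord0.
rewrite (_ : path_sum g n.+1 = fun w => path_sum g n w +
    \sum_a (draw n w == a)%:R * g n w (obs n w) a); last first.
  apply/funext => w; rewrite /path_sum big_ord_recr/=; congr (_ + _).
  rewrite (bigD1 (draw n w))//= eqxx mul1r big1 ?addr0// => a.
  by rewrite eq_sym => /negbTE ->; rewrite mul0r.
apply: measurable_funD; first exact: (measurable_OF_le (leqnSn n) IH).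
apply: measurable_sum => a; apply: measurable_funM;
  first exact: measurable_draw.
apply: (@measurableT_comp _ _ _ _ _ _ (fun z : OF n * XR => g n z.1 z.2 a) _
  (fun w : OF n.+1 => ((w : OF n), obs n w))); first exact: ag.
apply: measurable_fun_pair; last exact: measurable_obs.
apply: (measurable_OF_le (leqnSn n)); exact: measurable_id.
Qed.

Lemma measurable_path_sum_Omega g n : adapted g ->
  measurable_fun setT (path_sum g n).
Proof.
move=> ag; apply: (@measurable_OF_Omega n _ _ (path_sum g n)).
exact: measurable_path_sum.
Qed.

Lemma integral_round t (f : A -> OF t * XR -> \bar R) :
  (forall a, measurable_fun setT (f a)) -> (forall a z, (0 <= f a z)%E) ->
  (\int[P]_w f (draw t w) ((w : OF t), obs t w) = \int[P]_w \int[D]_v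
    \sum_(a : A) (aprob (epochs_done tau t) w v.1 a)%:E *
      f a ((w : OF t), v))%E.
Proof.
have /andP[ept _] := epochs_doneP t sched.
apply: (one_round (P := P) (D := D) (y := obs t) (act := draw t)
  (q := fun w v a => aprob (epochs_done tau t) w v.1 a)).
- exact: filtration_sigma_algebra.
- exact: filtration_measurable.
- exact: (measurable_OF_Omega (@measurable_obs t)).
- by move=> a; apply: (@filtration_measurable t.+1);
    exact: (run_adapted_act run).
- by move=> E B FE mB; exact: (run_iid run).
- by move=> w v a; rewrite ltW// aprob_gt0.
- by move=> a; exact: measurable_aprob.
- by move=> E B a FE mB; exact: (run_draw run).
Qed.

(** The one-round bound is assumed for every past [w], so the factor of the earlier rounds, constant
    once [w] is fixed, comes out of the inner integral and the last round can be peeled off. *)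
Lemma integral_expR_path_sum g n : adapted g ->
  (forall t w, (t < n)%N -> (\int[D]_v
    (\sum_a aprob (epochs_done tau t) w v.1 a * expR (g t w v a))%:E <= 1)%E) ->
  (\int[P]_w (expR (path_sum g n w))%:E <= 1)%E.
Proof.
move=> ag; elim: n => [|n IH] gle.
  rewrite (eq_integral (cst 1%:E)); last first.
    by move=> w _; rewrite /path_sum big_ord0 expR0.
  by rewrite integral_cst// mul1e probability_le1.
apply: le_trans (IH _); last by move=> t w tn; apply: gle; exact: ltnW.
pose f a (z : OF n * XR) :=
  (expR (path_sum g n z.1) * expR (g n z.1 z.2 a))%:E.
rewrite (eq_integral (fun w => f (draw n w) ((w : OF n), obs n w))); last first.
  by move=> w _; rewrite /f/= -expRD /path_sum big_ord_recr.
have mpath : measurable_fun setT (path_sum g n : OF n -> R).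
  exact: measurable_path_sum.
rewrite (@integral_round n f); last 2 first.
- move=> a; apply/measurable_EFinP; apply: measurable_funM.
    apply: measurableT_comp => //.
    exact: (measurableT_comp mpath measurable_fst).
  exact: measurableT_comp.
- by move=> a z; rewrite lee_fin mulr_ge0 ?expR_ge0.
pose h (z : OF n * XR) :=
  (\sum_(a : A) (aprob (epochs_done tau n) z.1 z.2.1 a)%:E * f a z)%E.
have h0 z : (0 <= h z)%E.
  by apply: sume_ge0 => a _;
    rewrite mule_ge0 ?lee_fin ?mulr_ge0 ?expR_ge0 ?ltW ?aprob_gt0.
have mexp a : measurable_fun setT (fun z : OF n * XR => expR (g n z.1 z.2 a)).
  exact: measurableT_comp.
have mp a := measurable_aprob a (proj1 (andP (epochs_doneP n sched))).
have mh : measurable_fun setT h.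
  apply: emeasurable_sum => a; apply: emeasurable_funM.
    by apply/measurable_EFinP.
  apply/measurable_EFinP; apply: measurable_funM => //.
  apply: measurableT_comp => //.
  exact: (measurableT_comp mpath measurable_fst).
apply: ge0_le_integral => //.
- move=> w _; apply: integral_ge0 => v _; apply: sume_ge0 => a _.
  by rewrite mule_ge0 ?lee_fin ?mulr_ge0 ?expR_ge0 ?ltW ?aprob_gt0.
- apply: (@measurable_OF_Omega n).
  exact: (measurable_fun_fubini_tonelli_F (m2 := D) _ mh h0).
- by apply/measurable_EFinP; apply: measurableT_comp => //;
    exact: measurable_path_sum_Omega.
- move=> w _; under eq_integral => v _.
    rewrite (_ : (\sum_a _)%E = ((expR (path_sum g n w))%:E *
      (\sum_a aprob (epochs_done tau n) w v.1 a * expR (g n w v a))%:E)%E);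
        last first.
      rewrite -EFinM mulr_sumr -sumEFin; apply: eq_bigr => a _.
      by rewrite -EFinM; congr EFin; rewrite mulrCA.
    over.
  rewrite ge0_integralZl//; last 2 first.
  + apply/measurable_EFinP; apply: measurable_sum => a.
    have mpw := measurable_fun_pair2 (w : OF n) (mp a).
    have mexpw := measurable_fun_pair2 (w : OF n) (mexp a).
    by apply: measurable_funM.
  + move=> v _; rewrite lee_fin sumr_ge0// => a _.
    by rewrite mulr_ge0 ?expR_ge0 ?ltW ?aprob_gt0.
  rewrite -[leRHS]mule1; apply: lee_wpmul2l; first by rewrite lee_fin expR_ge0.
  exact: gle.
Qed.

(** * Clipped rewards, expected rewards and variance proxies *)

Definition good : set XR := [set v | forall a, 0 <= reward v.2 a <= 1].

Lemma measurable_good : measurable good.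
Proof.
rewrite (_ : good = \bigcap_(a in [set: A])
    [set v | (0 <= reward v.2 a) && (reward v.2 a <= 1)]).
  apply: fin_bigcap_measurable => // a _.
  have m : measurable_fun setT
      (fun v : XR => (0 <= reward v.2 a) && (reward v.2 a <= 1)).
    by apply: measurable_and; apply: measurable_fun_ler;
      by [exact: measurable_reward|exact: measurable_cst].
  have := m measurableT [set true] => /(_ I).
  by rewrite setTI preimage_true.
by apply/seteqP; split=> v gv a => [_|]; exact: gv.
Qed.

Lemma good1 : D good = 1%E.
Proof. exact: rD. Qed.

(* Rewards lie in [0, 1] only almost surely; clipping makes them bounded. *)
Definition clip (v : XR) (a : A) : R := Num.min 1 (Num.max 0 (reward v.2 a)).

Lemma clip_bounds v a : 0 <= clip v a <= 1.
Proof. by rewrite /clip le_min ler01 le_max lexx/= ge_min lexx. Qed.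

Lemma clipE v a : good v -> clip v a = reward v.2 a.
Proof.
move=> /(_ a)/andP[r0 r1]; rewrite /clip max_r//; exact: min_r.
Qed.

Lemma measurable_clip a : measurable_fun setT (fun v => clip v a).
Proof.
apply: (measurable_minr (f := cst 1)) => //.
by apply: (measurable_maxr (f := cst 0)) => //; exact: measurable_reward.
Qed.

Lemma measurable_at_policy d1 (T1 : measurableType d1) (f : T1 -> A -> R)
    (x : T1 -> X) (p : Pi) : measurable_fun setT x ->
  (forall a, measurable_fun setT (f ^~ a)) ->
  measurable_fun setT (fun z => f z (val p (x z))).
Proof.
move=> mx mf.
rewrite (_ : (fun z => _) = fun z => \sum_a (val p (x z) == a)%:R * f z a).
  apply: measurable_sum => a; apply: measurable_funM => //.
  exact: measurableT_comp (measurable_policy_eq p a) mx.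
apply/funext => z;
  rewrite (bigD1 (val p (x z)))//= eqxx mul1r big1 ?addr0// => a.
by rewrite eq_sym => /negbTE ->; rewrite mul0r.
Qed.

Lemma bounded_clip_policy (p : Pi) :
  bounded_measurable (fun v : XR => clip v (val p v.1)).
Proof.
split; last first.
  by exists 1 => v; have /andP[c0 c1] := clip_bounds v (val p v.1);
    rewrite ger0_norm.
by apply: measurable_at_policy measurable_fst _ => a; exact: measurable_clip.
Qed.

(** An expected reward rather than a loss. Clipping makes it a real number, and [policy_rewardE]
    identifies it with the expectation under [D]. *)
Definition risk (p : Pi) : R := Ex D (fun v => clip v (val p v.1)).

Lemma policy_rewardE p : policy_reward D p = (risk p)%:E.
Proof.
rewrite /policy_reward /risk EFin_Ex; last exact: bounded_clip_policy.
rewrite unlock; apply: ae_eq_integral => //.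
- apply/measurable_EFinP.
  apply: (@measurable_at_policy _ _ (fun v : XR => reward v.2) fst) => // a.
  exact: measurable_reward.
- by apply/measurable_EFinP; case: (bounded_clip_policy p).
- exists (~` good); split.
  + by apply: measurableC; exact: measurable_good.
  + by rewrite [LHS](probability_setC D measurable_good) good1 subee.
  + by move=> v /= nv gv; apply: nv => _; rewrite clipE.
Qed.

Lemma risk_bounds p : 0 <= risk p <= 1.
Proof.
apply/andP; split.
  rewrite -(Ex_cst D 0); apply: le_Ex => [||v].
  - exact: bounded_measurable_cst.
  - exact: bounded_clip_policy.
  - by case/andP: (clip_bounds v (val p v.1)).
rewrite -(Ex_cst D 1); apply: le_Ex => [||v].
- exact: bounded_clip_policy.
- exact: bounded_measurable_cst.
- by case/andP: (clip_bounds v (val p v.1)).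
Qed.

Definition inv_prob k w (p : Pi) (x : X) : R := (aprob k w x (val p x))^-1.

Lemma inv_prob_bounds k w p x : 0 < inv_prob k w p x <= (mu k)^-1.
Proof.
rewrite invr_gt0 aprob_gt0/= lef_pV2 ?posrE ?aprob_gt0 ?mu_gt0//.
exact: aprob_ge_mu.
Qed.

Lemma measurable_inv_prob k t p : (tau k <= t)%N ->
  measurable_fun setT (fun z : OF t * XR => inv_prob k z.1 p z.2.1).
Proof.
move=> kt; apply: measurable_invr_gt0; last by move=> z; exact: aprob_gt0.
apply: (@measurable_at_policy _ _ (fun z : OF t * XR => aprob k z.1 z.2.1)).
  exact: measurableT_comp measurable_fst measurable_snd.
by move=> a; exact: measurable_aprob.
Qed.

Lemma bounded_inv_prob k w p :
  bounded_measurable (fun v : XR => inv_prob k w p v.1).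
Proof.
split.
  have := measurable_fun_pair2 (w : OF (tau k))
    (measurable_inv_prob p (leqnn (tau k))).
  exact.
exists (mu k)^-1 => v; have /andP[i0 i1] := inv_prob_bounds k w p v.1.
by rewrite gtr0_norm.
Qed.

(** For rewards in [0, 1] this dominates the conditional second moment of the importance-weighted
    reward [ips]. *)
Definition variance_bound k w (p : Pi) : R :=
  Ex D (fun v => inv_prob k w p v.1).

Lemma measurable_variance_bound k t p : (tau k <= t)%N ->
  measurable_fun setT ((fun w => variance_bound k w p) : OF t -> R).
Proof.
move=> kt.
apply: (@measurableT_comp _ _ _ _ _ _ (@fine R) _
  (fun w : OF t => \int[D]_v (inv_prob k w p v.1)%:E)%E);
    first exact: fine_measurable.
have mf : measurable_fun setT
  (fun z : OF t * XR => (inv_prob k z.1 p z.2.1)%:E).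
  by apply/measurable_EFinP; exact: measurable_inv_prob.
apply: (measurable_fun_fubini_tonelli_F (m2 := D) _ mf) => z.
by rewrite lee_fin ltW//; case/andP: (inv_prob_bounds k z.1 p z.2.1).
Qed.

(** * Increments with conditional exponential moment at most 1 *)

Definition ips k w (p : Pi) (v : XR) (a : A) : R :=
  reward v.2 a * (val p v.1 == a)%:R / aprob k w v.1 a.

(* The scale [mu m / 2] keeps the exponent below 1/2 in every round before
   [tau m], where the drawn action has probability at least [mu m]. *)
Definition reward_increment (sgn : R) m (p : Pi) (t : nat) w v a : R :=
  let l := mu m / 2 in let k := epochs_done tau t in
  sgn * l * (ips k w p v a - risk p) - 2 * l ^+ 2 * variance_bound k w p.

Lemma adapted_reward_increment sgn m p : adapted (reward_increment sgn m p).
Proof.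
move=> t a; have /andP[kt _] := epochs_doneP t sched.
apply: measurable_funB; apply: measurable_funM => //.
  apply: measurable_funB => //.
  apply: measurable_funM; first apply: measurable_funM.
  - exact: (measurableT_comp (measurable_reward a) measurable_snd).
  - apply: (measurableT_comp (measurable_policy_eq p a)).
    exact: measurableT_comp measurable_fst measurable_snd.
  - by apply: measurable_invr_gt0; [exact: measurable_aprob|move=> z;
      exact: aprob_gt0].
have := measurable_variance_bound p kt.
by move=> mv; exact: (measurableT_comp mv measurable_fst).
Qed.

(** Under [aprob] the estimate [ips] is unbiased and its second moment is at most [inv_prob]; the
    quadratic bound on the exponential turns these two moments into the two terms that the increment
    subtracts. *)
Lemma reward_increment_step sgn m p t w : sgn ^+ 2 = 1 -> (t < tau m)%N ->
  (\int[D]_v (\sum_a aprob (epochs_done tau t) w v.1 a *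
    expR (reward_increment sgn m p t w v a))%:E <= 1)%E.
Proof.
move=> sgn2 tm; have /andP[kt _] := epochs_doneP t sched.
have sgn1 := sqr_eq1_le1 sgn2.
set k := epochs_done tau t in kt *.
have km : mu m <= mu k.
  apply: min_prob_noninc card_act_gt0 card_policies_gt0 delta01 sched _ _ _.
  exact/ltnW/epochs_done_lt.
pose l := mu m / 2.
have l0 : 0 < l by rewrite divr_gt0 ?mu_gt0.
pose Phi v := \sum_a aprob k w v.1 a * expR (sgn * l * ips k w p v a).
pose h v := sgn * l * clip v (val p v.1) + 2 * l ^+ 2 * inv_prob k w p v.1.
pose c := sgn * l * risk p + 2 * l ^+ 2 * variance_bound k w p.
rewrite (eq_integral (fun v => (expR (- c) * Phi v)%:E)); last first.
  move=> v _; congr EFin; rewrite /Phi mulr_sumr; apply: eq_bigr => a _.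
  rewrite mulrCA; congr (_ * _); rewrite -expRD; congr expR.
  by rewrite /reward_increment -/l -/k /c; ring.
have bh1 := bounded_measurableZ (sgn * l) (bounded_clip_policy p).
have bh2 := bounded_measurableZ (2 * l ^+ 2) (bounded_inv_prob k w p).
apply: (integral_exp_step measurable_good good1 (h := h)).
- apply: measurable_sum => a; apply: measurable_funM.
    exact: (measurable_fun_pair2 (w : OF t) (measurable_aprob a kt)).
  apply: measurableT_comp => //; apply: measurable_funM => //.
  apply: measurable_funM; first apply: measurable_funM => //.
  + exact: measurable_reward.
  + exact: measurableT_comp (measurable_policy_eq p a) measurable_fst.
  + apply: measurable_invr_gt0; last by move=> v; exact: aprob_gt0.
    exact: (measurable_fun_pair2 (w : OF t) (measurable_aprob a kt)).
- by move=> v; apply: sumr_ge0 => a _;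
    rewrite mulr_ge0 ?expR_ge0 ?ltW ?aprob_gt0.
- exact: bounded_measurableD.
- move=> v gv; rewrite /Phi /h clipE//=.
  set b := val p v.1.
  have r01 := gv b.
  have y_le a : sgn * l * ips k w p v a <= 2^-1.
    have /andP[a0 a1] := gv a.
    have ap0 := aprob_gt0 k w v.1 a.
    have ap_ge : mu m <= aprob k w v.1 a := le_trans km (aprob_ge_mu k w v.1 a).
    have ips0 : 0 <= ips k w p v a by rewrite divr_ge0 ?(ltW ap0)// mulr_ge0.
    have lips : l * ips k w p v a <= 2^-1.
      rewrite /ips mulrA ler_pdivrMr// /l.
      rewrite (@le_trans _ _ (mu m / 2 * 1))//; last by lra.
      rewrite ler_wpM2l// ?(ltW l0)//.
      by case: (_ == _); rewrite ?mulr1 ?mulr0.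
    have li0 : 0 <= l * ips k w p v a by apply: mulr_ge0 => //; exact: ltW.
    by apply: le_trans lips; rewrite -mulrA ler_piMl.
  apply: (@le_trans _ _ (\sum_a aprob k w v.1 a *
      (1 + sgn * l * ips k w p v a + 2 * (sgn * l * ips k w p v a) ^+ 2))).
    by apply: ler_sum => a _;
      rewrite ler_wpM2l ?expR_le_quadratic// ltW// aprob_gt0.
  (* Only the action [b] of [p] contributes beyond the constant 1: its probability cancels in the
     linear term and survives once, inverted, in the square. *)
  have -> : \sum_a aprob k w v.1 a *
      (1 + sgn * l * ips k w p v a + 2 * (sgn * l * ips k w p v a) ^+ 2) =
    1 + (sgn * l * reward v.2 b +
      2 * l ^+ 2 * (reward v.2 b ^+ 2 * inv_prob k w p v.1)).
    transitivity (\sum_a (aprob k w v.1 a +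
        (if a == b then sgn * l * reward v.2 b +
          2 * l ^+ 2 * (reward v.2 b ^+ 2 * inv_prob k w p v.1) else 0))).
      apply: eq_bigr => a _; rewrite /ips eq_sym -/b.
      case: eqP => [->|_];
        last by rewrite !(mulr0, mul0r, expr0n, addr0, mulr1).
      rewrite /inv_prob -/b.
      have -> : l ^+ 2 = sgn ^+ 2 * l ^+ 2 by rewrite sgn2 mul1r.
      rewrite -[true%:R]/(1 : R); field; by rewrite gt_eqF// aprob_gt0.
    by rewrite big_split/= sum_aprob1 -big_mkcond/= big_pred1_eq.
  have /andP[i0 _] := inv_prob_bounds k w p v.1.
  rewrite !lerD2l; apply: ler_wpM2l; first by rewrite mulr_ge0 ?sqr_ge0.
  apply: ler_piMl; first exact: ltW.
  by have /andP[r0 r1] := r01; rewrite expr_le1.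
- by rewrite ExD// !ExZ//; [exact: bounded_inv_prob|exact: bounded_clip_policy].
Qed.

(* For [s] of size [n ~ 1 / mu] drawn i.i.d. from Q, [n * agreement s p x] has
   expectation comparable to 1/Q^mu(p(x)|x). *)
Definition agreement (s : seq Pi) (p : Pi) (x : X) : R :=
  (1 + (count (fun q => val q x == val p x) s)%:R)^-1.

(** For values in [0, 1], half the mean minus the value has exponential moment at most 1. No
    variance term or scale is needed, at the price of a factor 2 between the true and the empirical
    mean. *)
Definition agreement_increment s p (t : nat) (w : Omega) (v : XR) (a : A) : R :=
  Ex D (fun v => agreement s p v.1) / 2 - agreement s p v.1.

Lemma agreement_bounds s p x : 0 < agreement s p x <= 1.
Proof.
have h : 1 <= 1 + (count (fun q => val q x == val p x) s)%:R :> R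
  by rewrite lerDl.
by rewrite invr_gt0 (lt_le_trans _ h)//= invf_le1// (lt_le_trans _ h).
Qed.

Lemma measurable_agreement s p :
  measurable_fun setT (fun v : XR => agreement s p v.1).
Proof.
apply: measurable_invr_gt0; last by move=> v; rewrite ltr_pwDl.
apply: measurable_funD => //.
rewrite (_ : (fun v => _) =
  fun v : XR => \sum_(q <- s) (val q v.1 == val p v.1)%:R).
  apply: measurable_sum => q.
  apply: (@measurable_at_policy _ _
    (fun v : XR => fun a => (val q v.1 == a)%:R) fst) => // a.
  exact: measurableT_comp (measurable_policy_eq q a) measurable_fst.
apply/funext => v; elim: s => [|q s IH]; first by rewrite big_nil.
by rewrite /= natrD IH big_cons.
Qed.

Lemma bounded_agreement s p :
  bounded_measurable (fun v : XR => agreement s p v.1).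
Proof.
split; first exact: measurable_agreement.
by exists 1 => v; have /andP[c0 c1] := agreement_bounds s p v.1;
  rewrite gtr0_norm.
Qed.

Lemma adapted_agreement_increment s p : adapted (agreement_increment s p).
Proof.
move=> t a; apply: measurable_funB => //.
exact: (measurableT_comp (measurable_agreement s p) measurable_snd).
Qed.

Lemma agreement_increment_step s p t w :
  (\int[D]_v (\sum_a aprob (epochs_done tau t) w v.1 a *
    expR (agreement_increment s p t w v a))%:E <= 1)%E.
Proof.
pose c := - 2^-1 * Ex D (fun v => agreement s p v.1).
rewrite (eq_integral (fun v => (expR (- c) * expR (- agreement s p v.1))%:E));
  last first.
  move=> v _; congr EFin; rewrite /agreement_increment -mulr_suml.
  by rewrite sum_aprob1 mul1r -expRD; congr expR; rewrite /c; ring.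
apply: (integral_exp_step measurable_good good1
  (h := fun v => - 2^-1 * agreement s p v.1)).
- apply: measurableT_comp => //; apply: measurableT_comp => //.
  exact: measurable_agreement.
- by move=> v; exact: expR_ge0.
- exact: bounded_measurableZ (bounded_agreement s p).
- move=> v _; have /andP[a0 a1] := agreement_bounds s p v.1.
  have := @expRN_le_1Bhalf _ (agreement s p v.1);
    rewrite (ltW a0) a1 => /(_ isT).
  by rewrite mulNr [2^-1 * _]mulrC.
- by rewrite ExZ//; exact: bounded_agreement.
Qed.

(** * Conditional regret of one round *)

Context (pistar : Pi).
Definition risk_gap (p : Pi) : R := risk pistar - risk p.

(* Dominates the conditional expectation of the regret of one round of epoch
   [k]; the first term pays for the uniform exploration. *)
Definition regret_bound k w : R :=
  2 * (#|A|%:R * mu k) + \sum_p weights k w p * risk_gap p.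

Definition regret_increment (l : R) (t : nat) w (v : XR) (a : A) : R :=
  l * (reward v.2 (val pistar v.1) - reward v.2 a)
  - l * regret_bound (epochs_done tau t) w - 2 * l ^+ 2.

Lemma adapted_regret_increment l : adapted (regret_increment l).
Proof.
move=> t a; have /andP[kt _] := epochs_doneP t sched.
apply: measurable_funB => //; apply: measurable_funB;
  apply: measurable_funM => //.
  apply: measurable_funB; last first.
    exact: (measurableT_comp (measurable_reward a) measurable_snd).
  apply: (@measurable_at_policy _ _ (fun z : OF t * XR => reward z.2.2)).
    exact: measurableT_comp measurable_fst measurable_snd.
  by move=> b; exact: (measurableT_comp (measurable_reward b) measurable_snd).
apply: measurable_funD => //; apply: measurable_sum => p.
apply: measurable_funM => //.
have mw := measurable_OF_le kt (@measurable_weights _ p).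
exact: (measurableT_comp mw measurable_fst).
Qed.

Lemma regret_increment_step l t w : 0 <= l <= 2^-1 ->
  (\int[D]_v (\sum_a aprob (epochs_done tau t) w v.1 a *
    expR (regret_increment l t w v a))%:E <= 1)%E.
Proof.
move=> /andP[l0 l2]; set k := epochs_done tau t.
pose y (v : XR) a := l * (reward v.2 (val pistar v.1) - reward v.2 a).
pose Phi v := \sum_a aprob k w v.1 a * expR (y v a).
pose S v :=
  \sum_p weights k w p * (clip v (val pistar v.1) + - clip v (val p v.1)).
pose h v := (2 * l ^+ 2 + l * (2 * (#|A|%:R * mu k))) + l * S v.
pose c := l * regret_bound k w + 2 * l ^+ 2.
rewrite (eq_integral (fun v => (expR (- c) * Phi v)%:E)); last first.
  move=> v _; congr EFin; rewrite /Phi mulr_sumr; apply: eq_bigr => a _.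
  rewrite mulrCA; congr (_ * _); rewrite -expRD; congr expR.
  by rewrite /regret_increment -/k /c /y; ring.
have bS1 (p : Pi) : bounded_measurable
    (fun v : XR => clip v (val pistar v.1) + - clip v (val p v.1)).
  have b1 := bounded_clip_policy pistar.
  have b2 := bounded_measurableN (bounded_clip_policy p).
  exact: bounded_measurableD b1 b2.
have bS : bounded_measurable S.
  by apply: bounded_measurable_sum => p; exact: bounded_measurableZ.
apply: (integral_exp_step measurable_good good1 (h := h)).
- have /andP[kt _] := epochs_doneP t sched.
  apply: measurable_sum => a; apply: measurable_funM.
    exact: (measurable_fun_pair2 (w : OF t) (measurable_aprob a kt)).
  apply: measurableT_comp => //; apply: measurable_funM => //.
  apply: measurable_funB; last exact: measurable_reward.
  apply: (@measurable_at_policy _ _ (fun v : XR => reward v.2) fst) => // b.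
  exact: measurable_reward.
- by move=> v; apply: sumr_ge0 => a _;
    rewrite mulr_ge0 ?expR_ge0 ?ltW ?aprob_gt0.
- by apply: bounded_measurableD;
    [exact: bounded_measurable_cst|exact: bounded_measurableZ].
- move=> v gv; rewrite /Phi /h.
  have SE : S v = \sum_p weights k w p *
      (reward v.2 (val pistar v.1) - reward v.2 (val p v.1)).
    by apply: eq_bigr => p _; rewrite !clipE.
  rewrite SE; set Sv := \sum_p weights k w p * _;
    set r1 := reward v.2 (val pistar v.1) in Sv *.
  have r1_01 : 0 <= r1 <= 1 := gv _.
  have Sv_ge : -1 <= Sv.
    rewrite -(weights_sum1 k w) -sumrN /Sv; apply: ler_sum => p _.
    rewrite -[leLHS]mulrN1 ler_wpM2l ?weights_ge0//.
    by have := gv (val p v.1); lra.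
  pose f a := 1 + 2 * l ^+ 2 + l * (r1 - reward v.2 a).
  apply: (@le_trans _ _ (\sum_a aprob k w v.1 a * f a)).
    apply: ler_sum => a _; rewrite ler_wpM2l ?(ltW (aprob_gt0 _ _ _ _))//.
    exact: regret_exp_le l0 l2 r1_01 (gv a).
  rewrite sum_aprob.
  have -> : \sum_p weights k w p * f (val p v.1) = 1 + 2 * l ^+ 2 + l * Sv.
    rewrite /Sv mulr_sumr -[X in X + _]mul1r.
    rewrite -[X in X * _ + _](weights_sum1 k w) mulr_suml.
    by rewrite -big_split; apply: eq_bigr => p _; rewrite /= /f; ring.
  have fsum : \sum_a f a <= #|A|%:R * (1 + 2 * l ^+ 2 + l).
    rewrite mulr_natl -sumr_const; apply: ler_sum => a _.
    by rewrite lerD2l ler_piMr//; have := gv a; lra.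
  have mu0 := mu_gt0 k; have Kmu := Kmu_le k.
  have K0 : 0 <= #|A|%:R * mu k by rewrite mulr_ge0 ?(ltW mu0).
  exact: (regret_mix_le (ltW mu0) K0 l0 Sv_ge fsum).
- rewrite ExD//; last 2 first.
  + exact: bounded_measurable_cst.
  + exact: bounded_measurableZ.
  rewrite Ex_cst ExZ// Ex_sum; last by move=> p; exact: bounded_measurableZ.
  rewrite (eq_bigr (fun p => weights k w p * risk_gap p)); last first.
    move=> p _; rewrite ExZ// ExD ?ExN//; last first.
    - by apply: bounded_measurableN; exact: bounded_clip_policy.
    - exact: bounded_clip_policy.
    - exact: bounded_clip_policy.
  by rewrite /c /regret_bound le_eqVlt; apply/orP; left; apply/eqP; ring.
Qed.

Lemma path_sum_tail g n e : 0 < e -> adapted g ->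
  (forall t w, (t < n)%N -> (\int[D]_v
    (\sum_a aprob (epochs_done tau t) w v.1 a * expR (g t w v a))%:E <= 1)%E) ->
  measurable [set w | ln e^-1 < path_sum g n w] /\
  (P [set w | (ln e^-1 < path_sum g n w)%R] <= e%:E)%E.
Proof.
move=> e0 ag gle; have mg := measurable_path_sum_Omega n ag; split.
  by apply: measurable_set_lt => //; exact: measurable_cst.
by apply: probability_markov_exp => //; exact: integral_expR_path_sum.
Qed.

(** * The exceptional event *)

Definition sign (b : bool) : R := (-1) ^+ b.

Lemma good_event (T : nat) (l : R) (n : nat -> nat) : 0 <= l <= 2^-1 ->
  exists B : set Omega,
    [/\ measurable B, (P B <= delta%:E)%E & forall w, ~ B w ->
    [/\ forall m p b, (0 < m <= T)%N ->
          path_sum (reward_increment (sign b) m p) (tau m) w <=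
          log_term #|` Pi| delta (tau m),
        forall m p s, (0 < m <= T)%N -> size s = n m ->
          path_sum (agreement_increment s p) (tau m) w <=
          (n m).+1%:R * log_term #|` Pi| delta (tau m)
      & path_sum (regret_increment l) T w <= ln (2 / delta)]].
Proof.
move=> l01; have /andP[d0 d1] := delta01.
have N0 : 0 < #|` Pi|%:R :> R by rewrite ltr0n card_policies_gt0.
have N1 : 1 <= #|` Pi|%:R :> R by rewrite ler1n card_policies_gt0.
have tau0 m : (0 < m)%N -> (0 < tau m)%N.
  by move=> m0; exact: leq_trans m0 (epoch_schedule_ge m sched).
have tau0R m : (0 < m)%N -> 0 < (tau m)%:R :> R by move/tau0; rewrite ltr0n.
(* [e1] is shared by [2 |Pi|] events (a policy and a sign), [e2] by [|Pi|^(n+1)] events (a policy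
   and an [n]-tuple). As the sum of [1 / tau^2] is at most 2, these cost [delta / 4] and [delta / 8]
   over all epochs, and the regret takes [delta / 2]. *)
pose e1 m := delta / (16 * (tau m)%:R ^+ 2 * #|` Pi|%:R).
pose e2 m := delta / (16 * (tau m)%:R ^+ 2 * #|` Pi|%:R ^+ (n m).+1).
have e1_gt0 m : (0 < m)%N -> 0 < e1 m.
  by move=> m0; rewrite divr_gt0 ?mulr_gt0 ?exprn_gt0 ?tau0R.
have e2_gt0 m : (0 < m)%N -> 0 < e2 m.
  by move=> m0; rewrite divr_gt0 ?mulr_gt0 ?exprn_gt0 ?tau0R.
pose B1 (m : 'I_T) := [set w | exists pb : Pi * bool,
  ln (e1 m.+1)^-1 <
    path_sum (reward_increment (sign pb.2) m.+1 pb.1) (tau m.+1) w].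
pose B2 (m : 'I_T) := [set w | exists ps : Pi * (n m.+1).-tuple Pi,
  ln (e2 m.+1)^-1 < path_sum (agreement_increment ps.2 ps.1) (tau m.+1) w].
pose B3 := [set w | ln (delta / 2)^-1 < path_sum (regret_increment l) T w].
have H1 m :
  measurable (B1 m) /\ (P (B1 m) <= (delta / 8 / (tau m.+1)%:R ^+ 2)%:E)%E.
  have e0 := e1_gt0 m.+1 isT.
  have Q (pb : Pi * bool) := path_sum_tail e0
    (adapted_reward_increment (sign pb.2) m.+1 pb.1)
    (fun t w tm => reward_increment_step pb.1 w (sqrr_sign R pb.2) tm).
  have [mB PB] :=
    probability_exists_le (fun pb => (Q pb).1) (fun pb => (Q pb).2).
  split=> //; apply: le_trans PB _;
    rewrite lee_fin sumr_const card_prod card_bool.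
  rewrite -cardfE -[_ *+ _]mulr_natr natrM /e1 le_eqVlt; apply/orP; left;
    apply/eqP.
  by field; rewrite !gt_eqF ?tau0R.
have H2 m :
  measurable (B2 m) /\ (P (B2 m) <= (delta / 16 / (tau m.+1)%:R ^+ 2)%:E)%E.
  have e0 := e2_gt0 m.+1 isT.
  have Q (ps : Pi * (n m.+1).-tuple Pi) := path_sum_tail e0
    (adapted_agreement_increment ps.2 ps.1)
    (fun t w (_ : (t < tau m.+1)%N) => agreement_increment_step ps.2 ps.1 t w).
  have [mB PB] :=
    probability_exists_le (fun ps => (Q ps).1) (fun ps => (Q ps).2).
  split=> //; apply: le_trans PB _;
    rewrite lee_fin sumr_const card_prod card_tuple.
  rewrite -cardfE -[_ *+ _]mulr_natr natrM natrX /e2 [_ ^+ (n _).+1]exprS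
    le_eqVlt.
  apply/orP; left; apply/eqP.
  by field; rewrite !gt_eqF ?tau0R// ?exprn_gt0.
have d2 : 0 < delta / 2 by rewrite divr_gt0.
have [mB3 PB3] := path_sum_tail d2 (adapted_regret_increment l)
  (fun t w (_ : (t < T)%N) => regret_increment_step t w l01).
have [mB1 PB1] := probability_exists_le (fun m => (H1 m).1) (fun m => (H1 m).2).
have [mB2 PB2] := probability_exists_le (fun m => (H2 m).1) (fun m => (H2 m).2).
exists ([set w | exists m, B1 m w] `|` ([set w | exists m, B2 m w] `|` B3));
  split.
- by apply: measurableU => //; exact: measurableU.
- have S2 : \sum_(m < T) ((tau m.+1)%:R ^+ 2)^-1 <= 2 :> R.
    apply: le_trans (sum_inv_sqr_le2 _ T); apply: ler_sum => m _.
    rewrite lef_pV2 ?posrE ?exprn_gt0 ?tau0R// lerXn2r ?nnegrE// ler_nat.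
    exact: epoch_schedule_ge.
  apply: (le_trans (measureU2 _ _ _)) => //; first exact: measurableU.
  apply: (@le_trans _ _ ((delta / 4)%:E + (delta / 8 + delta / 2)%:E)%E).
    apply: leeD.
      apply: le_trans PB1 _; rewrite lee_fin -mulr_sumr.
      by have := S2; nra.
    apply: (le_trans (measureU2 _ _ _)) => //.
    rewrite EFinD; apply: leeD => //.
    apply: le_trans PB2 _; rewrite lee_fin -mulr_sumr.
    by have := S2; nra.
  by rewrite -EFinD lee_fin; lra.
- move=> w /not_orP[nB1 /not_orP[nB2 nB3]]; split.
  + move=> [//|m] p b /andP[_ mT]; rewrite leNgt; apply/negP => h.
    apply: nB1; exists (Ordinal mT); exists (p, b) => /=.
    by rewrite (_ : ln _ = log_term #|` Pi| delta (tau m.+1))// /e1 invf_div.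
  + move=> [//|m] p s /andP[_ mT] sn; rewrite leNgt; apply/negP => h.
    have /eqP st := sn.
    apply: nB2; exists (Ordinal mT); exists (p, Tuple st) => /=.
    apply: le_lt_trans h; rewrite /log_term mulr_natl -lnXn; last first.
      by rewrite (lt_le_trans _
        (log_arg_ge16 card_policies_gt0 delta01 (tau0 _ _))).
    rewrite /e2 invf_div ler_ln ?posrE; last 2 first.
    * by rewrite divr_gt0 ?mulr_gt0 ?exprn_gt0 ?tau0R.
    * by rewrite exprn_gt0 ?divr_gt0 ?mulr_gt0 ?exprn_gt0 ?tau0R.
    (* Since [1 <= u], [u N^(n+1) <= (u N)^(n+1)]: the union over tuples is paid with [n + 1] copies
       of [log_term]. *)
    set u : R := 16 * (tau m.+1)%:R ^+ 2 / delta.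
    have u1 : 1 <= u.
      have t1 : 1 <= (tau m.+1)%:R ^+ 2 :> R by rewrite exprn_ege1// ler1n tau0.
      by rewrite /u ler_pdivlMr//; lra.
    have -> : 16 * (tau m.+1)%:R ^+ 2 * #|` Pi|%:R / delta = u * #|` Pi|%:R.
      by rewrite /u; ring.
    have -> : 16 * (tau m.+1)%:R ^+ 2 * #|` Pi|%:R ^+ (n m.+1).+1 / delta =
        u * #|` Pi|%:R ^+ (n m.+1).+1 by rewrite /u; ring.
    rewrite exprMn ler_pM2r ?exprn_gt0// -[leLHS]expr1.
    by apply: ler_weXn2l.
  + by rewrite leNgt; apply/negP => h; apply: nB3; rewrite /B3/= invf_div.
Qed.

(** * Estimates and variances outside the exceptional event *)

Lemma hist_sum (g : entry R X A -> R) w t :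
  \sum_(h <- hist delta tau (Z w) t) g h =
  \sum_(i < t) g (Entry (obs i w).1 (draw i w) (reward (obs i w).2 (draw i w))
    (aprob (epochs_done tau i) w (obs i w).1 (draw i w))).
Proof.
rewrite big_map (_ : iota 1 t = index_iota 1 t.+1);
  last by rewrite /index_iota subn1.
by rewrite big_add1 big_mkord.
Qed.

Lemma size_hist w t : size (hist delta tau (Z w) t) = t.
Proof. by rewrite size_map size_iota. Qed.

Definition mean_variance m w p : R :=
  (tau m)%:R^-1 * \sum_(t < tau m) variance_bound (epochs_done tau t) w p.

Lemma mean_variance_le m w p (c : R) : (0 < m)%N ->
  (forall k, (k < m)%N -> variance_bound k w p <= c) ->
    mean_variance m w p <= c.
Proof.
move=> m0 Vc; have t0 : 0 < (tau m)%:R :> R.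
  by rewrite ltr0n (leq_trans m0)// epoch_schedule_ge.
rewrite /mean_variance ler_pdivrMl// mulr_natl.
rewrite -[X in _ *+ X]card_ord -sumr_const; apply: ler_sum => t _.
exact/Vc/epochs_done_lt.
Qed.

(** Divide the two tail bounds by [tau mu / 2]: the variance term becomes [mu] times the mean
    variance, and the logarithm, equal to [K tau mu^2], becomes [2 K mu]. *)
Lemma reward_deviation m w p : mu m < 1 / (2 * #|A|%:R) ->
  (forall b, path_sum (reward_increment (sign b) m p) (tau m) w <=
    log_term #|` Pi| delta (tau m)) ->
  `|ips_reward (hist delta tau (Z w) (tau m)) p - risk p| <=
  mu m * mean_variance m w p + 2 * (#|A|%:R * mu m).
Proof.
move=> sm dev.
have [m0] := min_prob_small card_act_gt0 card_policies_gt0 delta01 sched sm.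
rewrite -/(mu m) => dE.
have t0 : 0 < (tau m)%:R :> R.
  by rewrite ltr0n (leq_trans m0)// epoch_schedule_ge.
have mu0 := mu_gt0 m.
rewrite /ips_reward size_hist hist_sum//= /mean_variance.
set S := \sum_(i < tau m) _; set V := \sum_(t < tau m) _.
have pathE b : path_sum (reward_increment (sign b) m p) (tau m) w =
    sign b * (mu m / 2) * (S - (tau m)%:R * risk p) - 2 * (mu m / 2) ^+ 2 * V.
  rewrite /path_sum /reward_increment sumrB -!mulr_sumr sumrB sumr_const
    card_ord.
  by rewrite -[risk p *+ _]mulr_natl.
have := dev true; have := dev false; rewrite !pathE dE /sign expr0 expr1.
set K : R := #|A|%:R; set t : R := (tau m)%:R; set r := risk p.
move=> h1 h2.
have -> : t^-1 * S - r = t^-1 * (S - t * r) by field; rewrite gt_eqF.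
rewrite normrM ger0_norm ?invr_ge0 ?(ltW t0)// ler_pdivrMl//.
have -> : t * (mu m * (t^-1 * V) + 2 * (K * mu m)) =
   mu m * V + 2 * (K * t * mu m) by field; rewrite gt_eqF.
rewrite ler_norml; apply/andP; split; rewrite -(ler_pM2l mu0); nra.
Qed.

Lemma Ex_iidE (V : probability XR R) (Q : Pi -> R) n (f : seq Pi -> XR -> R) :
  (forall s, bounded_measurable (f s)) ->
  bounded_measurable (fun v => iidE Q n (f^~ v)) /\
  Ex V (fun v => iidE Q n (f^~ v)) = iidE Q n (fun s => Ex V (f s)).
Proof.
elim: n f => [|n IH] f bf; first by split => //=; exact: bf.
have bj j :=
  bounded_measurableZ (Q j) (IH (fun s => f (j :: s)) (fun s => bf _)).1.
split; first exact: bounded_measurable_sum.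
rewrite /= Ex_sum//; apply: eq_bigr => j _.
have [b e] := IH (fun s => f (j :: s)) (fun s => bf _).
by rewrite ExZ// e.
Qed.

(** With [q] the weight of the policies agreeing with [p] at [x], the probability is
    [(1 - K mu) q + mu], where [1 - K mu >= 1/2]. So [n] times it is comparable to [1 + n q] when
    [n] is of order [1 / mu], and [1 / (1 + n q)] is the mean agreement up to a factor 2. The next
    lemma is the converse. *)
Lemma inv_prob_le_agreement k w (p : Pi) x n : (mu k)^-1 <= n%:R ->
  inv_prob k w p x <=
  2 * n%:R * iidE (weights k w) n (fun s => agreement s p x).
Proof.
move=> nmu; have mu0 := mu_gt0 k; have Kmu := Kmu_le k.
have w0 := weights_ge0 k w.
pose q : R := \sum_(j : Pi | val j x == val p x) weights k w j.
have q0 : 0 <= q by apply: sumr_ge0.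
have n0 : 0 < n%:R :> R by apply: lt_le_trans nmu; rewrite invr_gt0.
have nmu1 : 1 <= n%:R * mu k by rewrite -ler_pdivrMr// div1r.
have nq0 : 0 < 1 + n%:R * q by rewrite ltr_pwDl// mulr_ge0.
apply: (@le_trans _ _ (2 * n%:R * (1 + n%:R * q)^-1)); last first.
  apply: ler_wpM2l; first by rewrite mulr_ge0.
  exact: (iidE_inv_ge w0 (weights_sum1 k w) (fun j => val j x == val p x) n).
have ap0 := aprob_gt0 k w x (val p x).
rewrite /inv_prob ler_pdivlMr// mulrC ler_pdivrMr//.
have -> : aprob k w x (val p x) = (1 - #|A|%:R * mu k) * q + mu k by [].
by have := mulr_ge0 (ltW n0) q0; nra.
Qed.

Lemma agreement_le_inv_prob k w (p : Pi) x n : n%:R * mu k <= 2 ->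
  n%:R * iidE (weights k w) n (fun s => agreement s p x) <=
  4 * inv_prob k w p x.
Proof.
move=> nmu; have mu0 := mu_gt0 k; have Kmu := Kmu_le k.
have w0 := weights_ge0 k w.
pose q : R := \sum_(j : Pi | val j x == val p x) weights k w j.
have q0 : 0 <= q by apply: sumr_ge0.
have nq0 : 0 < 1 + n%:R * q by rewrite ltr_pwDl// mulr_ge0.
apply: (@le_trans _ _ (n%:R * (2 * (1 + n%:R * q)^-1))).
  apply: ler_wpM2l => //.
  exact: (iidE_inv_le w0 (weights_sum1 k w) (fun j => val j x == val p x) n).
have ap0 := aprob_gt0 k w x (val p x).
rewrite /inv_prob mulrA ler_pdivrMr// mulrAC ler_pdivlMr//.
have -> : aprob k w x (val p x) = (1 - #|A|%:R * mu k) * q + mu k by [].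
have n0 : 0 <= n%:R :> R by [].
have K0 : 0 <= #|A|%:R * mu k by rewrite mulr_ge0// ltW.
have := mulr_ge0 (mulr_ge0 n0 q0) K0.
by nra.
Qed.

(** The tail bound holds for all [s] at once, so it may be averaged over [s] drawn from the weights
    of this very outcome. The factor 16 is 2 and 4 from the two comparisons with agreement, times 2
    from the halved mean. *)
Lemma variance_transfer m w (p : Pi) n : mu m < 1 / (2 * #|A|%:R) ->
  (mu m)^-1 <= n%:R -> n.+1%:R * mu m <= 2 ->
  (forall s, size s = n -> path_sum (agreement_increment s p) (tau m) w <=
    n.+1%:R * log_term #|` Pi| delta (tau m)) ->
  variance_bound m w p <=
  16 * ((tau m)%:R^-1 * \sum_(t < tau m) inv_prob m w p (obs t w).1) +
  16 * #|A|%:R.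
Proof.
move=> sm nmu n1mu dev.
have [m0] := min_prob_small card_act_gt0 card_policies_gt0 delta01 sched sm.
rewrite -/(mu m) => dE.
have t0 : 0 < (tau m)%:R :> R.
  by rewrite ltr0n (leq_trans m0)// epoch_schedule_ge.
have mu0 := mu_gt0 m.
have n2mu : n%:R * mu m <= 2.
  by apply: le_trans n1mu; rewrite ler_pM2r// ler_nat.
have [bi Ei] := Ex_iidE D (weights m w) n (fun s => bounded_agreement s p).
set c : R := 2 * n.+1%:R * (#|A|%:R * mu m ^+ 2).
have Es s : size s = n -> Ex D (fun v : XR => agreement s p v.1) <=
    2 * (tau m)%:R^-1 * \sum_(t < tau m) agreement s p (obs t w).1 + c.
  move=> sn; have := dev s sn; rewrite dE.
  rewrite {1}/path_sum /agreement_increment sumrB sumr_const card_ord.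
  rewrite -[_ *+ _]mulr_natl /c.
  set E := Ex D _; set S := \sum_(t < tau m) _ => h.
  rewrite -(ler_pM2l t0).
  have -> : (tau m)%:R * (2 * (tau m)%:R^-1 * S +
      2 * n.+1%:R * (#|A|%:R * mu m ^+ 2)) =
    2 * S + 2 * (n.+1%:R * (#|A|%:R * (tau m)%:R * mu m ^+ 2)).
    by field; rewrite gt_eqF.
  by lra.
have w0 := weights_ge0 m w.
apply: (@le_trans _ _ (Ex D (fun v : XR => 2 * n%:R *
    iidE (weights m w) n (fun s => agreement s p v.1)))).
  apply: le_Ex; first exact: bounded_inv_prob.
    exact: bounded_measurableZ.
  by move=> v; exact: inv_prob_le_agreement.
rewrite ExZ// Ei.
apply: (@le_trans _ _ (2 * n%:R * (2 * (tau m)%:R^-1 *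
    \sum_(t < tau m) iidE (weights m w) n (fun s => agreement s p (obs t w).1)
      + c))).
  apply: ler_wpM2l; first by rewrite mulr_ge0.
  apply: le_trans (le_iidE w0 Es) _.
  by rewrite iidED iidEZ iidE_sum (iidE_cst (weights_sum1 m w)).
rewrite mulrDr; apply: lerD.
  have -> (S : R) : 2 * n%:R * (2 * (tau m)%:R^-1 * S) =
    4 * ((tau m)%:R^-1 * (n%:R * S)) by ring.
  have -> (S : R) : 16 * ((tau m)%:R^-1 * S) = 4 * ((tau m)%:R^-1 * (4 * S)).
    by ring.
  rewrite ler_pM2l// ler_pM2l ?invr_gt0// !mulr_sumr; apply: ler_sum => t _.
  exact: agreement_le_inv_prob.
have -> : 2 * n%:R * c = 4 * #|A|%:R * ((n%:R * mu m) * (n.+1%:R * mu m)).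
  by rewrite /c; ring.
have -> : 16 * #|A|%:R = 4 * #|A|%:R * (2 * 2) :> R by ring.
apply: ler_wpM2l; first by rewrite mulr_ge0.
by apply: ler_pM => //; rewrite mulr_ge0// ltW.
Qed.

(** The constraint of (OP) concerns [Q], while the run plays its completion; completing only
    increases weights, hence only decreases the inverse probabilities. *)
Lemma empirical_variance_le m w (p : Pi) : (0 < m)%N ->
  (tau m)%:R^-1 * \sum_(t < tau m) inv_prob m w p (obs t w).1 <=
  2 * #|A|%:R +
  op_slack (hist delta tau (Z w) (tau m)) (ldr (Z w) (tau m)) (mu m) p.
Proof.
move=> m0; have [_ _ /(_ m m0)[_ _ /(_ p)]] := run_updates run w.
apply: le_trans; rewrite /emp_expectation size_hist.
rewrite (hist_sum (fun h => 1 / smoothed (wgt (Z w) m) (mu m)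
  (val p (e_ctx h)) (e_ctx h))).
apply: ler_wpM2l; first by rewrite invr_ge0.
apply: ler_sum => t _; rewrite /inv_prob div1r /=.
have mu0 := mu_gt0 m; have Kmu := Kmu_le m.
have K1 : 0 <= 1 - #|A|%:R * mu m by lra.
have [w0 _] := wgt_subdistribution m w.
have s0 : 0 < smoothed (wgt (Z w) m) (mu m) (val p (obs t w).1) (obs t w).1.
  by rewrite ltr_wpDl// mulr_ge0// sumr_ge0.
have ap0 := aprob_gt0 m w (obs t w).1 (val p (obs t w).1).
rewrite lef_pV2 ?posrE//.
rewrite lerD2r; apply: ler_wpM2l => //; apply: ler_sum => j _.
exact: wgt_le_weights.
Qed.

(** The two comparisons with agreement ask for [n] at least [1 / mu] and at most [2 / mu]
    respectively. *)
Definition sample_size (m : nat) : nat := (Num.truncn (mu m)^-1).+1.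

Lemma sample_size_bounds m :
  (mu m)^-1 <= (sample_size m)%:R /\ (sample_size m).+1%:R * mu m <= 2.
Proof.
have mu0 := mu_gt0 m; have Kmu := Kmu_le m.
have i0 : 0 <= (mu m)^-1 by rewrite invr_ge0 ltW.
have /andP[h1 h2] := truncn_itv i0.
split; first exact: ltW.
have K1 : 1 <= #|A|%:R :> R by rewrite ler1n card_act_gt0.
rewrite /sample_size -!natr1 -ler_pdivlMr//.
have mu2 : mu m <= 2^-1.
  by apply: le_trans Kmu; rewrite ler_peMl// ltW.
have : 2 <= (mu m)^-1 by rewrite -[leLHS]invrK lef_pV2 ?posrE.
by lra.
Qed.

Lemma variance_le m w (p : Pi) : mu m < 1 / (2 * #|A|%:R) ->
  (forall s, size s = sample_size m ->
    path_sum (agreement_increment s p) (tau m) w <=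
    (sample_size m).+1%:R * log_term #|` Pi| delta (tau m)) ->
  variance_bound m w p <= 48 * #|A|%:R +
    16 * op_slack (hist delta tau (Z w) (tau m)) (ldr (Z w) (tau m)) (mu m) p.
Proof.
move=> sm dev; have [b1 b2] := sample_size_bounds m.
have [m0 _] := min_prob_small card_act_gt0 card_policies_gt0 delta01 sched sm.
have := variance_transfer sm b1 b2 dev; have := empirical_variance_le w p m0.
by lra.
Qed.

Lemma variance_bound_le_inv k w (p : Pi) : variance_bound k w p <= (mu k)^-1.
Proof.
rewrite -[leRHS](Ex_cst D); apply: le_Ex.
- exact: bounded_inv_prob.
- exact: bounded_measurable_cst.
- by move=> v; case/andP: (inv_prob_bounds k w p v.1).
Qed.

Lemma log_term_le s t : (0 < s)%N -> (s <= t)%N ->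
  log_term #|` Pi| delta s <= log_term #|` Pi| delta t :> R.
Proof.
move=> s0 st; have /andP[d0 d1] := delta01.
have N0 : 0 < #|` Pi|%:R :> R by rewrite ltr0n card_policies_gt0.
have pos u : (0 < u)%N -> 0 < 16 * u%:R ^+ 2 * #|` Pi|%:R / delta :> R.
  by move=> u0; rewrite divr_gt0 ?mulr_gt0 ?exprn_gt0 ?ltr0n ?card_policies_gt0.
rewrite /log_term ler_ln ?posrE ?pos ?(leq_trans s0)//.
rewrite ler_pM2r ?invr_gt0// ler_pM2r// ler_pM2l// lerXn2r ?nnegrE//.
by rewrite ler_nat.
Qed.

(** In a later epoch [t + 1 <= 2 tau k] turns [mu] into [1 / sqrt (t + 1)]. Doubling says nothing
    about epoch 0, whose fewer than [c + 1] rounds are charged 1/2 each; this is where the bound on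
    [tau 1] enters. *)
Lemma mu_epoch_le (c t T : nat) : (tau 1 <= c)%N -> (t < T)%N ->
  #|A|%:R * mu (epochs_done tau t) <= (t < c)%:R / 2 +
    Num.sqrt (2 * #|A|%:R * log_term #|` Pi| delta T) * (Num.sqrt t.+1%:R)^-1.
Proof.
move=> tc tT; have Kmu := Kmu_le (epochs_done tau t).
have mu0 := mu_gt0 (epochs_done tau t).
have K0 : 0 < #|A|%:R :> R by rewrite ltr0n card_act_gt0.
have /andP[] := epochs_doneP t sched.
have s0 : 0 <= Num.sqrt (2 * #|A|%:R * log_term #|` Pi| delta T) *
    (Num.sqrt t.+1%:R)^-1.
  by rewrite mulr_ge0// invr_ge0 sqrtr_ge0.
case k0 : (epochs_done tau t) Kmu mu0 => [|k] Kmu mu0 kt tk.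
  by rewrite (leq_trans tk tc) -[true%:R]/(1 : R) div1r; lra.
have tau0 : (0 < tau k.+1)%N
  by rewrite (leq_trans _ (epoch_schedule_ge k.+1 sched)).
apply: (@le_trans _ _ (Num.sqrt (2 * #|A|%:R * log_term #|` Pi| delta T) *
  (Num.sqrt t.+1%:R)^-1)); last by rewrite lerDr divr_ge0.
have LT : log_term #|` Pi| delta (tau k.+1) <= log_term #|` Pi| delta T :> R.
  by apply: log_term_le => //; rewrite (leq_trans kt)// ltnW.
have L0 : 0 < log_term #|` Pi| delta (tau k.+1) :> R.
  exact: lt_trans (log_term_gt2 card_policies_gt0 delta01 tau0).
rewrite -sqrtrV// -sqrtrM; last first.
  by rewrite !mulr_ge0// (le_trans _ LT)// ltW.
rewrite -[leLHS]ger0_norm ?mulr_ge0 ?(ltW mu0) ?(ltW K0)// -sqrtr_sqr.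
apply: ler_wsqrtr; rewrite ler_pdivlMr ?ltr0n//.
have t0 : 0 < (tau k.+1)%:R :> R by rewrite ltr0n.
have t2 : t.+1%:R <= 2 * (tau k.+1)%:R :> R.
  rewrite -natrM ler_nat (leq_trans tk)//.
  by case: sched => _ _ ->.
have := min_prob_sqr_le card_act_gt0 card_policies_gt0 delta01 sched (ltn0Sn k).
rewrite -/(mu k.+1) ler_pdivlMr ?mulr_gt0// => mu2.
apply: (@le_trans _ _ ((#|A|%:R * mu k.+1) ^+ 2 * (2 * (tau k.+1)%:R))).
  by rewrite ler_wpM2l ?sqr_ge0.
have -> : (#|A|%:R * mu k.+1) ^+ 2 * (2 * (tau k.+1)%:R) =
  2 * #|A|%:R * (mu k.+1 ^+ 2 * (#|A|%:R * (tau k.+1)%:R)) by ring.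
by apply: ler_wpM2l; [rewrite mulr_ge0|exact: le_trans mu2 LT].
Qed.

(** * From gaps to the regret of the run *)

Context (opt : optimal_policy D pistar).
Lemma risk_le_opt (p : Pi) : risk p <= risk pistar.
Proof. by have := opt p; rewrite !policy_rewardE lee_fin. Qed.

(** [1002 = 2 + 2 * 200 + 600]: exploration, twice the empirical regret allowed by (OP) ([2 K] times
    [100 mu]), and the additive error of the gap comparison. The mass given to the leader costs only
    that error, its empirical regret being 0. At the cap, gaps are at most [1 <= 2 K mu]. *)
Lemma regret_bound_le k w :
  (forall p : Pi, mu k < 1 / (2 * #|A|%:R) -> risk_gap p <=
    2 * emp_regret (hist delta tau (Z w) (tau k)) (ldr (Z w) (tau k)) p +
    600 * (#|A|%:R * mu k)) ->
  regret_bound k w <= 1002 * (#|A|%:R * mu k).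
Proof.
move=> gapP; have mu0 := mu_gt0 k.
have K0 : 0 < #|A|%:R :> R by rewrite ltr0n card_act_gt0.
have Kmu0 : 0 < #|A|%:R * mu k by rewrite mulr_gt0.
have w0 := weights_ge0 k w; rewrite /regret_bound.
have [sm|big] := ltP (mu k) (1 / (2 * #|A|%:R)); last first.
  have Kmu : 2^-1 <= #|A|%:R * mu k.
    by rewrite -ler_pdivrMl// -invfM mulrC -div1r.
  suff : \sum_p weights k w p * risk_gap p <= 1 by lra.
  rewrite -[leRHS](weights_sum1 k w); apply: ler_sum => p _.
  rewrite ler_piMr// /risk_gap.
  by have := risk_bounds p; have := risk_bounds pistar; lra.
have [k0 _] := min_prob_small card_act_gt0 card_policies_gt0 delta01 sched sm.
have [_ _ /(_ k k0)[[Q0 Q1] QB _]] := run_updates run w.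
set l := ldr (Z w) (tau k) in gapP QB *.
set H := hist delta tau (Z w) (tau k) in gapP QB *.
set Q := wgt (Z w) k in Q0 Q1 QB *.
have -> : \sum_p weights k w p * risk_gap p =
    \sum_p Q p * risk_gap p + (1 - \sum_p Q p) * risk_gap l.
  rewrite /weights /completed -/Q -/l; under eq_bigr do rewrite mulrDl.
  rewrite big_split/=; congr (_ + _).
  transitivity (\sum_(p | p == l) (1 - \sum_q Q q) * risk_gap p).
    rewrite [RHS]big_mkcond; apply: eq_bigr => p _.
    by case: eqP; rewrite ?mulr1 ?mulr0 ?mul0r.
  by rewrite big_pred1_eq.
have gl : risk_gap l <= 600 * (#|A|%:R * mu k).
  by have := gapP l sm; rewrite /emp_regret subrr mulr0 add0r.
have QB' : \sum_p Q p * emp_regret H l p <= 200 * (#|A|%:R * mu k).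
  have -> : \sum_p Q p * emp_regret H l p =
      100 * mu k * \sum_p Q p * op_slack H l (mu k) p.
    rewrite mulr_sumr; apply: eq_bigr => p _.
    by rewrite /op_slack /psi; field; rewrite gt_eqF.
  have := ler_wpM2l (mulr_ge0 (ler0n R 100) (ltW mu0)) QB; lra.
have : \sum_p Q p * risk_gap p <=
    2 * (\sum_p Q p * emp_regret H l p) + 600 * (#|A|%:R * mu k) * \sum_p Q p.
  rewrite !mulr_sumr -big_split/=; apply: ler_sum => p _.
  have := ler_wpM2l (Q0 p) (gapP p sm); lra.
have : (1 - \sum_p Q p) * risk_gap l <=
    (1 - \sum_p Q p) * (600 * (#|A|%:R * mu k)).
  by apply: ler_wpM2l => //; lra.
by lra.
Qed.

Lemma regret_le w T l : 0 < l ->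
  path_sum (regret_increment l) T w <= ln (2 / delta) ->
  regret (Z w) pistar T <= \sum_(t < T) regret_bound (epochs_done tau t) w +
    (2 * l * T%:R + ln (2 / delta) / l).
Proof.
move=> l0; rewrite /regret big_add1 big_mkord.
set S := \sum_(t < T) _; set G := \sum_(t < T) regret_bound _ _.
have -> : path_sum (regret_increment l) T w =
    l * S - l * G - T%:R * (2 * l ^+ 2).
  rewrite /S /G !mulr_sumr [T%:R * _]mulr_natl -[X in _ *+ X]card_ord.
  by rewrite -sumr_const -!sumrB.
move=> h; rewrite -(ler_pM2l l0).
have -> : l * (G + (2 * l * T%:R + ln (2 / delta) / l)) =
  l * G + (T%:R * (2 * l ^+ 2) + ln (2 / delta)) by field; rewrite gt_eqF.
by lra.
Qed.

Lemma regret_path_sum w T : regret (Z w) pistar T =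
  path_sum (fun t w v a => reward v.2 (val pistar v.1) - reward v.2 a) T w.
Proof. by rewrite /regret big_add1 big_mkord. Qed.

Lemma measurable_regret T :
  measurable_fun setT (fun w => regret (Z w) pistar T).
Proof.
under eq_fun do rewrite regret_path_sum.
apply: measurable_path_sum_Omega => t a; apply: measurable_funB; last first.
  exact: (measurableT_comp (measurable_reward a) measurable_snd).
apply: (@measurable_at_policy _ _ (fun z : OF t * XR => reward z.2.2)).
  exact: measurableT_comp measurable_fst measurable_snd.
by move=> b; exact: (measurableT_comp (measurable_reward b) measurable_snd).
Qed.

Lemma sum_ltn_le (c T : nat) : (\sum_(t < T) (t < c) <= c)%N.
Proof.
suff -> : (\sum_(t < T) (t < c))%N = minn T c by exact: geq_minr.
elim: T => [|T IH]; first by rewrite big_ord0 min0n.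
rewrite big_ord_recr/= IH; case: (ltnP T c) => h.
  by rewrite addn1 (minn_idPl h).
by rewrite addn0 (minn_idPr (leqW h)).
Qed.

(** Write [y = T |Pi| / delta]. From [2 <= y] come [16 <= y^4] and [2 / delta <= y^2], so numerical
    constants are absorbed into powers of [y]. *)
Lemma ln_bounds (T : nat) : (0 < T)%N -> 2 <= T%:R * #|` Pi|%:R / delta ->
  let L := ln (T%:R * #|` Pi|%:R / delta) in
  [/\ 2^-1 <= L, log_term #|` Pi| delta T <= 6 * L & ln (2 / delta) <= 2 * L].
Proof.
move=> T0; have /andP[d0 d1] := delta01.
have N1 : 1 <= #|` Pi|%:R :> R by rewrite ler1n card_policies_gt0.
have T1 : 1 <= T%:R :> R by rewrite ler1n.
set t : R := T%:R in T1 *; set N : R := #|` Pi|%:R in N1 *.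
set y := t * N / delta => y2 L; have y0 : 0 < y by lra.
have tN : 1 <= t * N by rewrite mulr_ege1.
have dy : delta^-1 <= y by rewrite /y ler_peMl// invr_ge0 ltW.
split.
- apply: le_trans (ltW ln2_gt_half) _; rewrite /L ler_ln ?posrE//.
- rewrite /log_term -/t -/N [6 * L]mulr_natl /L -lnXn// ler_ln ?posrE
    ?exprn_gt0//; last first.
    by rewrite divr_gt0// !mulr_gt0// ?exprn_gt0//; lra.
  have -> : 6%N = (4 + 2)%N by [].
  rewrite exprD; apply: (@le_trans _ _ (16 * y ^+ 2)); last first.
    rewrite ler_pM2r ?exprn_gt0//.
    have -> : 16 = 2 ^+ 4 :> R by rewrite -natrX.
    by rewrite lerXn2r ?nnegrE// ltW.
  have -> : 16 * t ^+ 2 * N / delta = 16 * (t ^+ 2 * (N / delta)) by ring.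
  rewrite ler_pM2l// /y -mulrA exprMn ler_pM2l ?exprn_gt0//; last lra.
  have h : 1 <= N / delta by rewrite ler_pdivlMr//; lra.
  by rewrite expr2 ler_peMl//; lra.
- rewrite [2 * L]mulr_natl /L -lnXn// ler_ln ?posrE ?exprn_gt0// ?divr_gt0//.
  by rewrite expr2; apply: ler_pM => //; rewrite invr_ge0 ltW.
Qed.

Lemma regret_good (c T : nat) : (tau 1 <= c)%N -> (0 < T)%N ->
  2 <= T%:R * #|` Pi|%:R / delta ->
  let L := ln (T%:R * #|` Pi|%:R / delta) in
  exists B : set Omega,
    [/\ measurable B, (P B <= delta%:E)%E & forall w, ~ B w ->
    regret (Z w) pistar T <= (8034 + 1002 * c%:R) *
      (Num.sqrt (#|A|%:R * T%:R * L) + #|A|%:R * L)].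
Proof.
move=> tc T0 y2; have /= [L2 dL LL] := ln_bounds T0 y2.
set L := ln _ in L2 dL LL *.
have /andP[d0 d1] := delta01.
have T1 : 1 <= T%:R :> R by rewrite ler1n.
have K1 : 1 <= #|A|%:R :> R by rewrite ler1n card_act_gt0.
have Lam0 : 0 < ln (2 / delta) by rewrite ln_gt0// ltr_pdivlMr//; lra.
have [/andP[l0 l2] lE] := sqrt_min_tradeoff T1 Lam0.
set l := Num.min _ _ in l0 l2 lE.
have l01 : 0 <= l <= 2^-1 by rewrite ltW.
have [B [mB PB Bw]] := good_event T sample_size l01.
exists B; split=> // w /Bw[devR devV devG].
have gapP k (p : Pi) : (k <= T)%N -> mu k < 1 / (2 * #|A|%:R) -> risk_gap p <=
    2 * emp_regret (hist delta tau (Z w) (tau k)) (ldr (Z w) (tau k)) p +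
    600 * (#|A|%:R * mu k).
  move=> kT sk.
  have small0 m : mu m < 1 / (2 * #|A|%:R) -> (0 < m)%N.
    by case/(min_prob_small card_act_gt0 card_policies_gt0 delta01 sched).
  have := @gap_comparison R Pi #|A|%:R (fun m => mu m) risk
    (fun m => ips_reward (hist delta tau (Z w) (tau m)))
    (fun m => ldr (Z w) (tau m)) (fun k p => variance_bound k w p)
    (fun m p => mean_variance m w p) pistar T.
  move=> H; apply: (proj1 (H _ _ _ _ _ _ _ _ _ _ k p kT sk)) => //.
  - by lra.
  - exact: mu_gt0.
  - by move=> i j;
      exact: min_prob_noninc card_act_gt0 card_policies_gt0 delta01 sched _ _.
  - exact: risk_le_opt.
  - by move=> m q; case: (run_updates run w) => + _ _; apply.
  - by move=> m q r m0; exact: mean_variance_le.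
  - move=> m q mT sm; apply: reward_deviation => // b; apply: devR.
    by rewrite mT small0.
  - move=> m q mT sm; apply: variance_le => // s sn; apply: devV => //.
    by rewrite mT small0.
  - by move=> m q; exact: variance_bound_le_inv.
apply: le_trans (regret_le l0 devG) _.
set q := Num.sqrt (#|A|%:R * T%:R * L).
have q0 : 0 <= q by exact: sqrtr_ge0.
have KTL0 : 0 <= #|A|%:R * T%:R * L by rewrite !mulr_ge0//; lra.
have sqrt_le (x z : R) : 0 <= z -> x <= z ^+ 2 * (#|A|%:R * T%:R * L) ->
  Num.sqrt x <= z * q.
  move=> z0 xz; apply: le_trans (ler_wsqrtr xz) _.
  by rewrite sqrtrM ?sqr_ge0// sqrtr_sqr ger0_norm.
have S1 : \sum_(t < T) #|A|%:R * mu (epochs_done tau t) <= c%:R / 2 + 8 * q.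
  apply: (@le_trans _ _ (\sum_(t < T) ((t < c)%:R / 2 +
    Num.sqrt (2 * #|A|%:R * log_term #|` Pi| delta T) *
      (Num.sqrt t.+1%:R)^-1))).
    by apply: ler_sum => t _; exact: mu_epoch_le.
  rewrite big_split/= -mulr_suml -mulr_sumr; apply: lerD.
    by rewrite ler_pM2r ?invr_gt0// -natr_sum ler_nat sum_ltn_le.
  apply: (@le_trans _ _ (Num.sqrt (2 * #|A|%:R * log_term #|` Pi| delta T) *
      (2 * Num.sqrt T%:R))).
    by apply: ler_wpM2l; [exact: sqrtr_ge0|exact: sum_invsqrt_le].
  have dT0 : 0 <= log_term #|` Pi| delta T :> R.
    by rewrite ltW// (lt_trans _ (log_term_gt2 card_policies_gt0 delta01 T0)).
  rewrite mulrCA -sqrtrM; last by rewrite mulr_ge0// mulr_ge0//; lra.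
  have -> : 8 * q = 2 * (4 * q) by ring.
  rewrite ler_pM2l//; apply: sqrt_le => //.
  have -> : 2 * #|A|%:R * log_term #|` Pi| delta T * T%:R =
    #|A|%:R * T%:R * (2 * log_term #|` Pi| delta T) by ring.
  have -> : 4 ^+ 2 * (#|A|%:R * T%:R * L) = #|A|%:R * T%:R * (16 * L) by ring.
  by apply: ler_wpM2l; [rewrite mulr_ge0//; lra|lra].
have S2 : \sum_(t < T) regret_bound (epochs_done tau t) w <=
    1002 * (\sum_(t < T) #|A|%:R * mu (epochs_done tau t)).
  rewrite mulr_sumr; apply: ler_sum => t _; apply: regret_bound_le => p sm.
  apply: gapP => //; have /andP[et _] := epochs_doneP t sched.
  by rewrite ltnW// (leq_ltn_trans (epoch_schedule_ge _ sched))//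
    (leq_ltn_trans et).
have S3 : Num.sqrt (T%:R * ln (2 / delta)) <= 2 * q.
  apply: sqrt_le => //.
  have -> : 2 ^+ 2 * (#|A|%:R * T%:R * L) = T%:R * (2 * (2 * (#|A|%:R * L)))
    by ring.
  apply: ler_wpM2l => //.
  have : L <= #|A|%:R * L by rewrite ler_peMl//; lra.
  by lra.
have KL : 2^-1 <= #|A|%:R * L.
  by apply: le_trans L2 _; rewrite ler_peMl//; lra.
have LKL : L <= #|A|%:R * L by rewrite ler_peMl//; lra.
have c0 : 0 <= c%:R :> R by [].
have cKL := ler_wpM2l c0 KL.
have cq : 0 <= c%:R * q by rewrite mulr_ge0.
(* [8034 = 1002 * 8 + 3 * 2 + 6 * 2]: the sum over epochs and the two terms of the scale trade-off.
   The first epoch leaves [1002 * c / 2], covered because [K L >= 1/2]. *)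
have -> : (8034 + 1002 * c%:R) * (q + #|A|%:R * L) =
  8034 * q + 8034 * (#|A|%:R * L) + 1002 * (c%:R * q) +
  1002 * (c%:R * (#|A|%:R * L)) by ring.
set KLv := #|A|%:R * L in KL LKL cKL *.
set cKLv := c%:R * KLv in cKL *.
by lra.
Qed.

(** With a single policy all weight lies on [pistar], whose action is drawn with probability at
    least [1 - K mu_0 >= 1/2]; the regret of that round is then 0. *)
Lemma regret_one_round : #|` Pi| = 1%N ->
  ((2^-1)%:E <= P [set w | (regret (Z w) pistar 1 <= 0)%R])%E.
Proof.
move=> N1.
have single (p : Pi) : p = pistar.
  have /card_le1_eqP H : (#|{: Pi}| <= 1)%N by rewrite -cardfE N1.
  exact: H.
have mE : measurable [set w | (regret (Z w) pistar 1 <= 0)%R].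
  by apply: measurable_set_le; [exact: measurable_regret|exact: measurable_cst].
pose f (a : A) (z : OF 0 * XR) : \bar R := ((val pistar z.2.1 == a)%:R)%:E.
have mf a : measurable_fun setT (fun z :
  OF 0 * XR => (val pistar z.2.1 == a)%:R : R).
  apply: (measurableT_comp (measurable_policy_eq pistar a)).
  exact: measurableT_comp measurable_fst measurable_snd.
apply: (@le_trans _ _ (\int[P]_w f (draw 0 w) ((w : OF 0), obs 0 w))%E).
  rewrite (@integral_round 0 f); last 2 first.
  - by move=> a; exact/measurable_EFinP.
  - by move=> a z; rewrite lee_fin.
  have aE w x : aprob 0 w x (val pistar x) = 1 - #|A|%:R * mu 0 + mu 0.
    rewrite aprobE (eq_bigr (fun p => weights 0 w p)); last first.
      by move=> p _; rewrite (single p) eqxx mulr1.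
    by rewrite weights_sum1 mulr1.
  rewrite (eq_integral (cst (1 - #|A|%:R * mu 0 + mu 0)%:E)); last first.
    move=> w _; rewrite (eq_integral (cst (1 - #|A|%:R * mu 0 + mu 0)%:E)).
      by rewrite integral_cst//= [X in (_ * X)%E](probability_setT D) mule1.
    move=> v _; rewrite (bigD1 (val pistar v.1))//= /f/= eqxx mule1 aE.
    rewrite big1 ?adde0// => a; rewrite eq_sym => /negbTE ->.
    by rewrite mule0.
  rewrite integral_cst//= [X in (_ * X)%E](probability_setT P) mule1 lee_fin.
  rewrite -[leRHS]/(1 - #|A|%:R * mu 0%N + mu 0%N).
  by have := Kmu_le 0%N; have := mu_gt0 0%N; lra.
rewrite -[X in P X]setIT -integral_indic//; apply: ge0_le_integral => //.
- by move=> w _; rewrite lee_fin.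
- apply/measurable_EFinP.
  rewrite (_ :
    (fun w => _) = path_sum (fun _ _ v a => (val pistar v.1 == a)%:R) 1).
    apply: measurable_path_sum_Omega => t a.
    apply: (measurableT_comp (measurable_policy_eq pistar a)).
    exact: measurableT_comp measurable_fst measurable_snd.
  by apply/funext => w; rewrite /path_sum big_ord1.
- exact/measurable_EFinP/measurable_indic.
- move=> w _; rewrite lee_fin /= indicE.
  case: eqP => [e|_]; last by [].
  rewrite mem_set//= regret_path_sum /path_sum big_ord1.
  by rewrite -e subrr.
Qed.

End Run.

Theorem theorem2 (R : realType) (c : nat) :
  exists C : R, 0 < C /\
  forall (d : measure_display) (X : measurableType d) (A : finType)
    (Pi : {fset (X -> A)}) (D : probability (X * rewards R A)%type R)
    (delta : R) (tau : nat -> nat)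
    (d' : measure_display) (Omega : measurableType d')
    (P : probability Omega R) (F : nat -> set (set Omega))
    (Z : Omega -> trajectory R Pi) (pistar : Pi),
  Pi != fset0%fset ->
  measurable_policies Pi ->
  reward_distribution D ->
  0 < delta < 1 ->
  epoch_schedule tau ->
  (tau 1%N <= c)%N ->
  ilovetoconbandits_run D delta tau P F Z ->
  optimal_policy D pistar ->
  forall T : nat, (1 <= T)%N ->
  let K : R := #|A|%:R in
  let L : R := ln (T%:R * #|` Pi|%:R / delta) in
  (P [set w | regret (Z w) pistar T <= C * (Num.sqrt (K * T%:R * L) + K * L)]%R
   >= (1 - delta)%:E)%E.
Proof.
have C0 : 0 < 8034 + 1002 * c%:R :> R.
  by apply: ltr_pwDl; [rewrite ltr0n|rewrite -natrM ler0n].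
exists (8034 + 1002 * c%:R); split; first exact: C0.
move=> d X A Pi D delta tau d' Omega P F Z pistar _ mPi rD d01 sched tc run opt.
move=> T T0; cbv zeta; set L := ln _.
set bound := ((8034 + 1002 * c%:R) * _)%R.
have /andP[d0 d1] := d01.
have mS : measurable [set w | regret (Z w) pistar T <= bound].
  apply: measurable_set_le; last exact: measurable_cst.
  exact: (measurable_regret mPi run).
have [y2|y2] := leP 2 (T%:R * #|` Pi|%:R / delta).
  have [B [mB PB Bw]] := regret_good mPi rD d01 sched run opt tc T0 y2.
  apply: (@le_trans _ _ (P (~` B))); last first.
    by apply: le_measure; rewrite ?inE//; exact: measurableC.
  by rewrite probability_setC// EFinB; apply: leeB.
(* Here [T |Pi| < 2 delta < 2], so [T = |Pi| = 1] and [1 - delta < 1/2]: a nonpositive regret with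
   probability 1/2 is enough. *)
have N0 := card_policies_gt0 Z.
have TN : (T * #|` Pi| <= 1)%N.
  rewrite -ltnS -(ltr_nat R) natrM.
  by move: y2; rewrite ltr_pdivrMr// => /lt_le_trans; apply; lra.
have TN1 : (T * #|` Pi|)%N = 1%N by apply/eqP;
  rewrite eqn_leq TN muln_gt0 T0 N0.
have /andP[/eqP ET /eqP EN] : (T == 1%N) && (#|` Pi| == 1%N).
  by rewrite -muln_eq1 TN1.
move: y2; rewrite ET EN mulr1 ltr_pdivrMr// => d2.
have L0 : 0 <= L by rewrite ln_ge0// ET EN mulr1 ler_pdivlMr// mul1r ltW.
apply: le_trans (le_trans _ (regret_one_round mPi d01 sched run pistar EN)) _.
  by rewrite lee_fin; lra.
rewrite ET in mS *.
apply: le_measure; rewrite ?inE//.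
- apply: measurable_set_le; last exact: measurable_cst.
  exact: (measurable_regret mPi run).
- move=> w /= /le_trans; apply.
  apply: mulr_ge0; first exact: ltW.
  by apply: addr_ge0; [exact: sqrtr_ge0|apply: mulr_ge0].
Qed.
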